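(* Let $X\in\mathbb{R}^{n\times n}$ be the measured rank $r$ matrix and let $T$ be the tangent space of the rank $r$ matrix manifold at $X$. Suppose $$\|\mathcal{P}_\Omega\|\le \tfrac{8}{3}\beta\log(n),\qquad \|\mathcal{P}_T-p^{-1}\mathcal{P}_T\mathcal{P}_\Omega\mathcal{P}_T\|\le\varepsilon_0,\qquad \frac{\|X_0-X\|_F}{\sigma_{\min}(X)}\le\frac{3p^{1/2}\varepsilon_0}{16\beta\log(n)(1+\varepsilon_0)},$$ where $\beta>1$ and $\varepsilon_0$ is a positive numerical constant. Assume that $\varepsilon_0$ obeys $\tau_1+\tau_2<1$, where $$\tau_1=\frac{18\varepsilon_0-10\kappa_1\varepsilon_0(1+4\varepsilon_0)}{(1-4\varepsilon_0)-\kappa_1(1+4\varepsilon_0)}+\frac{4\kappa_2\varepsilon_0+\kappa_1\kappa_2}{1-4\varepsilon_0},\qquad \tau_2=\frac{8\kappa_2\varepsilon_0+2\kappa_1\kappa_2}{1-4\varepsilon_0}.$$ Then $\nu_{cg}=\frac12\left(\tau_1+\sqrt{\tau_1^2+4\tau_2}\right)<1$, and the iterates $X_l$ generated by the restarted Riemannian conjugate gradient descent algorithm (restarted RCG, see context) with restarting parameters $\kappa_1,\kappa_2\ge0$, started from $X_0$, satisfy $$\|X_l-X\|_F\le\nu_{cg}^{\,l}\,\|X_0-X\|_F.$$ When $\kappa_1=\kappa_2=0$, the condition $\tau_1+\tau_2<1$ is reduced to $\frac{18\varepsilon_0}{1-4\varepsilon_0}<1$. On the other hand, $$\lim_{\varepsilon_0\to0}(\tau_1+\tau_2)=3\kappa_1\kappa_2,$$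 so if $\kappa_1\kappa_2<1/3$, $\tau_1+\tau_2$ can be less than one when $\varepsilon_0$ is small. In particular, when $\kappa_1=0.1$ and $\kappa_2=1$, a sufficient condition for $\tau_1+\tau_2<1$ is $\varepsilon_0\le0.01$.
   Context: $\Omega$ is a collection of $m$ indices in $\{1,\dots,n\}^2$ (counted with multiplicity) and $p=m/n^2$. $\mathcal{P}_\Omega(Z)$ is the entrywise product of $Z$ with $\sum_{(i,j)\in\Omega}e_ie_j^*$, repeated indices being counted with multiplicity. $\|\cdot\|_F$ is the Frobenius norm; $\langle\cdot,\cdot\rangle$ is the Frobenius inner product; $\sigma_{\min}(X)$ is the smallest nonzero singular value of $X$; the norm $\|\mathcal{A}\|$ of a linear operator $\mathcal{A}$ on $\mathbb{R}^{n\times n}$ is its spectral norm (operator norm with respect to the Frobenius norm). Tangent space: for a rank $r$ matrix $Y$ with reduced SVD $Y=U_Y\Sigma_YV_Y^*$, the tangent space of the rank $r$ matrix manifold at $Y$ is $\{U_YZ_1^*+Z_2V_Y^*: Z_1,Z_2\in\mathbb{R}^{n\times r}\}$, and $\mathcal{P}_{T}$ denotes the orthogonal projection onto a tangent space $T$. Hard thresholding: $\mathcal{H}_r(Z)$ computes the SVD of $Z$ and sets all but the $r$ largest singular values to zero. Restarted RCG: given the rank $r$ matrix $X_0=U_0\Sigma_0V_0^*$, set $\beta_0=0$ and $P_{-1}=0$. For $l=0,1,\dots$ let $T_l$ be the tangent space at $X_l$ and set 1. $G_l=\mathcal{P}_\Omega(X-X_l)$; 2. (for $l\ge1$) $\beta_l=-\dfrac{\langle\mathcal{P}_{T_l}(G_l),\mathcal{P}_\Omega\mathcal{P}_{T_l}(P_{l-1})\rangle}{\langle\mathcal{P}_{T_l}(P_{l-1}),\mathcal{P}_\Omega\mathcal{P}_{T_l}(P_{l-1})\rangle}$,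 except that $\beta_l$ is set to $0$ (restarting) as long as either of the following conditions is violated: $$\frac{|\langle\mathcal{P}_{T_l}(G_l),\mathcal{P}_{T_l}(P_{l-1})\rangle|}{\|\mathcal{P}_{T_l}(G_l)\|_F\|\mathcal{P}_{T_l}(P_{l-1})\|_F}\le\kappa_1,\qquad \|\mathcal{P}_{T_l}(G_l)\|_F\le\kappa_2\|\mathcal{P}_{T_l}(P_{l-1})\|_F;$$ 3. $P_l=\mathcal{P}_{T_l}(G_l)+\beta_l\mathcal{P}_{T_l}(P_{l-1})$; 4. $\alpha_l=\dfrac{\langle\mathcal{P}_{T_l}(G_l),\mathcal{P}_{T_l}(P_l)\rangle}{\langle\mathcal{P}_{T_l}(P_l),\mathcal{P}_\Omega\mathcal{P}_{T_l}(P_l)\rangle}$; 5. $W_l=X_l+\alpha_lP_l$; 6. $X_{l+1}=\mathcal{H}_r(W_l)$.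
   Formalization: The convergence claim (and ν_cg<1) assumes the denominator (1−4ε0)−κ1(1+4ε0) is positive, since otherwise it fails (e.g. κ1=κ2=0, ε0=1/2 gives ν_cg=0); the limit 3κ1κ2 is stated for κ1≠1, as at κ1=1 it is 3κ2−1. *)

(* Defs.v *)
From mathcomp Require Import all_boot all_order all_algebra.
From mathcomp Require Import all_classical all_reals all_analysis.

Set Implicit Arguments.
Unset Strict Implicit.
Unset Printing Implicit Defensive.

Import Order.TTheory GRing.Theory Num.Theory.
Import numFieldNormedType.Exports.

Local Open Scope classical_set_scope.
Local Open Scope ring_scope.

Section MatrixCompletion.
Variables (R : realType) (n : nat).
Implicit Types (X Y Z W : 'M[R]_n) (A : 'M[R]_n -> 'M[R]_n) (T : set 'M[R]_n).

Definition frob_inner Z W : R := \sum_i \sum_j Z i j * W i j.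

Definition frob_norm Z : R := Num.sqrt (frob_inner Z Z).

Definition op_norm A : R :=
  sup [set frob_norm (A Z) | Z in [set Z | frob_norm Z <= 1]].

(* [k = n] gives full SVDs; [k = \rank Z] gives reduced SVDs.  The singular
   values [s] are listed in nonincreasing order. *)
Definition is_svd (k : nat) Z (U : 'M[R]_(n, k)) (s : 'rV[R]_k)
    (V : 'M[R]_(n, k)) : Prop :=
  [/\ U^T *m U = 1%:M,
      V^T *m V = 1%:M,
      forall i, 0 <= s 0 i,
      forall i j : 'I_k, (i <= j)%N -> s 0 j <= s 0 i &
      Z = U *m diag_mx s *m V^T].

Definition is_reduced_svd (r : nat) Z (U : 'M[R]_(n, r)) (s : 'rV[R]_r)
    (V : 'M[R]_(n, r)) : Prop :=
  is_svd Z U s V /\ forall i, 0 < s 0 i.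

Definition sigma_min X : R :=
  inf [set x : R | 0 < x /\ exists (U : 'M[R]_n) (s : 'rV[R]_n) (V : 'M[R]_n),
                     is_svd X U s V /\ exists i, x = s 0 i].

(* The space does not depend on the choice of the reduced SVD. *)
Definition tangent_space (r : nat) Y : set 'M[R]_n :=
  [set Z | exists (U : 'M[R]_(n, r)) (s : 'rV[R]_r) (V : 'M[R]_(n, r)),
     is_reduced_svd Y U s V /\
     exists Z1 Z2 : 'M[R]_(n, r), Z = U *m Z1^T + Z2 *m V^T].

Definition orth_proj T Z : 'M[R]_n :=
  xget 0 [set W | T W /\ forall W', T W' -> frob_inner (Z - W) W' = 0].

(* A relation, because the truncated SVD is not unique when the r-th and the
   (r+1)-st singular values of Z coincide. *)
Definition hard_threshold (r : nat) Z Y : Prop :=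
  exists (U : 'M[R]_n) (s : 'rV[R]_n) (V : 'M[R]_n),
    is_svd Z U s V /\
    Y = U *m diag_mx (\row_i (if (i < r)%N then s 0 i else 0)) *m V^T.

Definition sampling_op (m : nat) (Omega : m.-tuple ('I_n * 'I_n)) Z : 'M[R]_n :=
  map2_mx *%R (\sum_(k <- Omega) delta_mx k.1 k.2) Z.

Section RestartedRCG.
Variables (m r : nat) (Omega : m.-tuple ('I_n * 'I_n)) (kappa1 kappa2 : R).
Variable X : 'M[R]_n.

Local Notation POmega := (sampling_op Omega).
Local Notation PT Y := (orth_proj (tangent_space r Y)).

(* Below, Y stands for X_l, Pprev for P_{l-1} and P for P_l. *)
Definition rcg_grad Y := POmega (X - Y).

Definition rcg_no_restart Y Pprev : bool :=
  let g := PT Y (rcg_grad Y) in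
  let q := PT Y Pprev in
  (`|frob_inner g q| / (frob_norm g * frob_norm q) <= kappa1) &&
  (frob_norm g <= kappa2 * frob_norm q).

Definition rcg_beta Y Pprev : R :=
  let g := PT Y (rcg_grad Y) in
  let q := PT Y Pprev in
  if rcg_no_restart Y Pprev
  then - (frob_inner g (POmega q) / frob_inner q (POmega q))
  else 0.

Definition rcg_alpha Y P : R :=
  let g := PT Y (rcg_grad Y) in
  let q := PT Y P in
  frob_inner g q / frob_inner q (POmega q).

Definition restarted_rcg (Xs Ps : nat -> 'M[R]_n) (alpha beta : nat -> R) :
    Prop :=
  forall l : nat,
    let Pprev := if l is l'.+1 then Ps l' else 0 in
    [/\ beta l = (if l is 0%N then 0 else rcg_beta (Xs l) Pprev),
        Ps l = PT (Xs l) (rcg_grad (Xs l)) + beta l *: PT (Xs l) Pprev,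
        alpha l = rcg_alpha (Xs l) (Ps l) &
        hard_threshold r (Xs l + alpha l *: Ps l) (Xs l.+1)].

End RestartedRCG.
End MatrixCompletion.

Section Rates.
Variables (R : realType) (kappa1 kappa2 eps : R).

Definition tau1 : R :=
  (18 * eps - 10 * kappa1 * eps * (1 + 4 * eps)) /
    ((1 - 4 * eps) - kappa1 * (1 + 4 * eps)) +
  (4 * kappa2 * eps + kappa1 * kappa2) / (1 - 4 * eps).

Definition tau2 : R :=
  (8 * kappa2 * eps + 2 * kappa1 * kappa2) / (1 - 4 * eps).

Definition nu_cg : R := (tau1 + Num.sqrt (tau1 ^+ 2 + 4 * tau2)) / 2.

End Rates.

(* Main.v *)
Require Import Defs.
From mathcomp Require Import all_boot all_order all_algebra.
From mathcomp Require Import all_classical all_reals all_analysis.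
From mathcomp Require Import ring lra.
Import Order.TTheory GRing.Theory Num.Theory.
Import numFieldNormedType.Exports.
Local Open Scope classical_set_scope.
Local Open Scope ring_scope.

Set Implicit Arguments.
Unset Strict Implicit.
Unset Printing Implicit Defensive.

(** With [P], [Q] the projections on the tangent spaces at the iterate [Y] and at [X], put
    [d := |Y - X| / sigma_min X].  Since [Y] and [X] have equal rank, [|P - Q| <= 2 d] and
    [|(1 - P) (Y - X)| <= d |Y - X|]; as [d] is of order [sqrt p * eps0], the restricted
    isometry of [p^-1 P_Omega] passes from the tangent space at [X] to the one at [Y] with
    constant [4 eps0].  It bounds [beta_l]; conjugacy [<P_l, P_Omega q> = 0] and the
    restart conditions give [|p alpha_l - 1| <= eta := 4 eps0 / D], where [D] is the first
    denominator of [tau1].  Best rank [r] approximation costs a factor [2], so with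
    [e_l := |X_l - X|]

      [e_(l+1) <= A e_l + 2 (1 + eta) c |P_(l-1)| / p],
      [|P_l| / p <= K e_l + c |P_(l-1)| / p],

    where [tau1 = A + c], [tau2 = 2 c] and [2 (1 + eta) K <= A + 2].  Eliminating [P_l]
    leaves the recurrence whose characteristic equation [nu^2 = tau1 nu + tau2] has the
    root [nu_cg]. *)

(** Put [L := 8/3 b ln n], a bound on |P_Omega|. The hypothesis on [X0] then reads
    [2 d L (1 + eps0) <= sqrt p * eps0]. The power [sqrt p] is the crux: exchanging the tangent
    spaces inside [p^-1 P_Omega] naively costs [d L / p]. But P_Omega is a nonnegative diagonal
    operator, so its square is at most [L] P_Omega, and restricted isometry at [X] gives |P_Omega
    Q|^2 <= L (1 + eps0) p. This gains one factor [sqrt p], and [d] supplies the other.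

    The error [X_l - X] is not tangent at [X_l], and restricted isometry says nothing about its
    normal part. That part is second order in the error, which pays for the crude bound on its
    sampled image.

    Tangent spaces are spanned by reduced SVDs with [r] positive singular values, so each iterate
    must have rank exactly [r]. An error below [sigma_min X] guarantees this, hence rank and error
    are controlled in a single induction. *)

Section Frobenius.
Variable R : realType.

(** Rectangular shapes are needed for singular factors and row vectors. On square matrices this is
    convertible to [frob_inner], and [mxnrm] to [frob_norm]. *)
Definition mxip p q (A B : 'M[R]_(p, q)) : R := \sum_i \sum_j A i j * B i j.
Definition mxnrm p q (A : 'M[R]_(p, q)) : R := Num.sqrt (mxip A A).

Lemma mxipE p q (A B : 'M[R]_(p, q)) : mxip A B = \tr (A^T *m B).
Proof.
rewrite /mxip exchange_big; apply: eq_bigr => j _; rewrite !mxE.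
by apply: eq_bigr => i _; rewrite !mxE.
Qed.

Lemma mxipC p q (A B : 'M[R]_(p, q)) : mxip A B = mxip B A.
Proof. by apply: eq_bigr => i _; apply: eq_bigr => j _; rewrite mulrC. Qed.

Lemma mxipDl p q (A B C : 'M[R]_(p, q)) : mxip (A + B) C = mxip A C + mxip B C.
Proof. by rewrite !mxipE raddfD /= mulmxDl raddfD. Qed.

Lemma mxipZl p q (a : R) (A C : 'M[R]_(p, q)) : mxip (a *: A) C = a * mxip A C.
Proof. by rewrite !mxipE linearZ /= -scalemxAl linearZ. Qed.

Lemma mxipDr p q (A B C : 'M[R]_(p, q)) : mxip C (A + B) = mxip C A + mxip C B.
Proof. by rewrite mxipC mxipDl !(mxipC C). Qed.

Lemma mxipZr p q (a : R) (A C : 'M[R]_(p, q)) : mxip C (a *: A) = a * mxip C A.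
Proof. by rewrite mxipC mxipZl mxipC. Qed.

Lemma mxipNl p q (A C : 'M[R]_(p, q)) : mxip (- A) C = - mxip A C.
Proof. by rewrite -scaleN1r mxipZl mulN1r. Qed.

Lemma mxipNr p q (A C : 'M[R]_(p, q)) : mxip C (- A) = - mxip C A.
Proof. by rewrite mxipC mxipNl mxipC. Qed.

Lemma mxip0l p q (C : 'M[R]_(p, q)) : mxip 0 C = 0.
Proof. by rewrite -(scale0r 0) mxipZl mul0r. Qed.

Lemma mxip0r p q (C : 'M[R]_(p, q)) : mxip C 0 = 0.
Proof. by rewrite mxipC mxip0l. Qed.

Definition mxip_lin := (mxipDl, mxipDr, mxipNl, mxipNr, mxipZl, mxipZr).

Lemma mxip_mulmxl p q k (M : 'M[R]_(p, k)) (A : 'M[R]_(k, q)) B :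
  mxip (M *m A) B = mxip A (M^T *m B).
Proof. by rewrite !mxipE trmx_mul mulmxA. Qed.

Lemma mxip_tr p q (A B : 'M[R]_(p, q)) : mxip A^T B^T = mxip A B.
Proof. by rewrite !mxipE trmxK mxtrace_mulC -mxtrace_tr trmx_mul trmxK. Qed.

Lemma mxip_mulmxr p q k (M : 'M[R]_(k, q)) (A : 'M[R]_(p, k)) B :
  mxip (A *m M) B = mxip A (B *m M^T).
Proof. by rewrite -mxip_tr trmx_mul mxip_mulmxl -[RHS]mxip_tr trmx_mul trmxK. Qed.

Lemma mxip_ge0 p q (A : 'M[R]_(p, q)) : 0 <= mxip A A.
Proof. by apply: sumr_ge0 => i _; apply: sumr_ge0 => j _; rewrite -expr2 sqr_ge0. Qed.

Lemma mxip_eq0 p q (A : 'M[R]_(p, q)) : (mxip A A == 0) = (A == 0).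
Proof.
apply/idP/idP => [|/eqP->]; last by rewrite mxip0l.
rewrite psumr_eq0 => [/allP h|i _]; last first.
  by apply: sumr_ge0 => j _; rewrite -expr2 sqr_ge0.
apply/eqP/matrixP => i j; rewrite mxE.
have := h i (mem_index_enum _); rewrite psumr_eq0 => [/allP /(_ j (mem_index_enum _)) /=|k _].
  by rewrite -expr2 sqrf_eq0 => /eqP.
by rewrite -expr2 sqr_ge0.
Qed.

Lemma mxnrm_ge0 p q (A : 'M[R]_(p, q)) : 0 <= mxnrm A.
Proof. exact: sqrtr_ge0. Qed.

Lemma sqr_mxnrm p q (A : 'M[R]_(p, q)) : mxnrm A ^+ 2 = mxip A A.
Proof. by rewrite sqr_sqrtr // mxip_ge0. Qed.

Lemma mxnrm_eq0 p q (A : 'M[R]_(p, q)) : (mxnrm A == 0) = (A == 0).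
Proof. by rewrite -mxip_eq0 -sqr_mxnrm sqrf_eq0. Qed.

Lemma mxnrm0 p q : mxnrm (0 : 'M[R]_(p, q)) = 0.
Proof. by apply/eqP; rewrite mxnrm_eq0. Qed.

Lemma mxnrm_gt0 p q (A : 'M[R]_(p, q)) : (0 < mxnrm A) = (A != 0).
Proof. by rewrite lt_def mxnrm_eq0 mxnrm_ge0 andbT. Qed.

Lemma mxnrm_le p q p' q' (A : 'M[R]_(p, q)) (B : 'M[R]_(p', q')) :
  (mxnrm A <= mxnrm B) = (mxip A A <= mxip B B).
Proof. by rewrite ler_sqrt // mxip_ge0. Qed.

Lemma mxnrm_le_sqr p q (A : 'M[R]_(p, q)) x :
  0 <= x -> (mxnrm A <= x) = (mxip A A <= x ^+ 2).
Proof. by move=> x0; rewrite -sqr_mxnrm ler_sqr ?nnegrE ?mxnrm_ge0. Qed.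

Lemma mxnrmZ p q a (A : 'M[R]_(p, q)) : mxnrm (a *: A) = `|a| * mxnrm A.
Proof. by rewrite /mxnrm mxipZl mxipZr mulrA -expr2 sqrtrM ?sqr_ge0 // sqrtr_sqr. Qed.

Lemma mxnrmN p q (A : 'M[R]_(p, q)) : mxnrm (- A) = mxnrm A.
Proof. by rewrite -scaleN1r mxnrmZ normrN1 mul1r. Qed.

Lemma mxnrm_tr p q (A : 'M[R]_(p, q)) : mxnrm A^T = mxnrm A.
Proof. by rewrite /mxnrm mxip_tr. Qed.

Lemma mxip_sqr_le p q (A B : 'M[R]_(p, q)) :
  mxip A B ^+ 2 <= mxip A A * mxip B B.
Proof.
have [/eqP|B0] := eqVneq (mxip B B) 0.
  by rewrite mxip_eq0 => /eqP->; rewrite !mxip0r mulr0 expr0n.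
have Bp : 0 < mxip B B by rewrite lt_def B0 mxip_ge0.
have := mxip_ge0 (mxip B B *: A - mxip A B *: B).
rewrite !mxip_lin (mxipC B A) => h.
rewrite -subr_ge0 -(pmulr_rge0 _ Bp); apply: le_trans h _.
by rewrite le_eqVlt; apply/orP; left; apply/eqP; ring.
Qed.

Lemma normr_mxip_le p q (A B : 'M[R]_(p, q)) :
  `|mxip A B| <= mxnrm A * mxnrm B.
Proof.
rewrite -ler_sqr ?nnegrE ?mulr_ge0 ?mxnrm_ge0 //.
by rewrite real_normK ?num_real // exprMn !sqr_mxnrm mxip_sqr_le.
Qed.

Lemma mxip_le p q (A B : 'M[R]_(p, q)) : mxip A B <= mxnrm A * mxnrm B.
Proof. exact: le_trans (ler_norm _) (normr_mxip_le _ _). Qed.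

Lemma mxnrmD p q (A B : 'M[R]_(p, q)) : mxnrm (A + B) <= mxnrm A + mxnrm B.
Proof.
rewrite mxnrm_le_sqr ?addr_ge0 ?mxnrm_ge0 // !mxip_lin (mxipC B A).
have := mxip_le A B; have := sqr_mxnrm A; have := sqr_mxnrm B; nra.
Qed.

Lemma mxnrmB p q (A B : 'M[R]_(p, q)) : mxnrm (A - B) <= mxnrm A + mxnrm B.
Proof. by rewrite -(mxnrmN B) mxnrmD. Qed.

Lemma mxnrm_distC p q (A B : 'M[R]_(p, q)) : mxnrm (A - B) = mxnrm (B - A).
Proof. by rewrite -mxnrmN opprB. Qed.

Lemma mxnrm_mul p q k (A : 'M[R]_(p, k)) (B : 'M[R]_(k, q)) :
  mxnrm (A *m B) <= mxnrm A * mxnrm B.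
Proof.
rewrite mxnrm_le_sqr ?mulr_ge0 ?mxnrm_ge0 // exprMn !sqr_mxnrm.
have -> : mxip B B = \sum_j \sum_k B k j * B k j by rewrite /mxip exchange_big.
rewrite {2}/mxip mulr_suml; apply: ler_sum => i _; rewrite mulr_sumr.
apply: ler_sum => j _; rewrite -expr2.
have -> : (A *m B) i j = mxip (row i A) (col j B)^T.
  by rewrite mxE /mxip big_ord1; apply: eq_bigr => l _; rewrite !mxE.
have -> : \sum_l A i l * A i l = mxip (row i A) (row i A).
  by rewrite /mxip big_ord1; apply: eq_bigr => l _; rewrite !mxE.
have -> : \sum_l B l j * B l j = mxip (col j B)^T (col j B)^T.
  by rewrite /mxip big_ord1; apply: eq_bigr => l _; rewrite !mxE.
exact: mxip_sqr_le.
Qed.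

End Frobenius.

(** * Existence of the singular value decomposition *)

Section SVDExistence.
Variable R : realType.

Lemma mxip_orthoL p q k (U : 'M[R]_(p, k)) (A B : 'M[R]_(k, q)) :
  U^T *m U = 1%:M -> mxip (U *m A) (U *m B) = mxip A B.
Proof. by move=> UU; rewrite mxip_mulmxl mulmxA UU mul1mx. Qed.

Lemma mxnrm_orthoL p q k (U : 'M[R]_(p, k)) (A : 'M[R]_(k, q)) :
  U^T *m U = 1%:M -> mxnrm (U *m A) = mxnrm A.
Proof. by move=> UU; rewrite /mxnrm mxip_orthoL. Qed.

Lemma mxip_orthoR p q k (V : 'M[R]_(p, k)) (A B : 'M[R]_(q, k)) :
  V^T *m V = 1%:M -> mxip (A *m V^T) (B *m V^T) = mxip A B.
Proof. by move=> VV; rewrite mxip_mulmxr trmxK -mulmxA VV mulmx1. Qed.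

Lemma mxnrm_orthoR p q k (V : 'M[R]_(p, k)) (A : 'M[R]_(q, k)) :
  V^T *m V = 1%:M -> mxnrm (A *m V^T) = mxnrm A.
Proof. by move=> VV; rewrite /mxnrm mxip_orthoR. Qed.

Lemma continuous_bigsum (T : topologicalType) I (s : seq I) (f : I -> T -> R) :
  (forall i, continuous (f i)) -> continuous (fun x => \sum_(i <- s) f i x).
Proof.
move=> cf; elim: s => [|a s IH].
  under eq_fun do rewrite big_nil; exact: cst_continuous.
under eq_fun do rewrite big_cons.
by move=> x; apply: (@continuousD _ R^o _ (f a) _ x); [exact: cf | exact: IH].
Qed.

Lemma continuous_mxip_mulmx n q (A : 'M[R]_(n, q)) :
  continuous (fun v : 'rV[R]_n => mxip (v *m A) (v *m A)).
Proof.
rewrite /mxip; apply: continuous_bigsum => i; apply: continuous_bigsum => j.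
have cA : continuous (fun v : 'rV[R]_n => (v *m A) i j).
  under eq_fun do rewrite mxE.
  apply: continuous_bigsum => k v.
  apply: (@continuousM _ _ (fun v : 'rV[R]_n => v i k)); first exact: coord_continuous.
  exact: cst_continuous.
by move=> v; apply: continuousM; exact: cA.
Qed.

(** The unit sphere is compact, and nonempty because the size is a successor; homogeneity carries
    the maximum from unit rows to all rows. *)
Lemma exists_max_unit_row n q (A : 'M[R]_(n.+1, q)) :
  exists2 v : 'rV[R]_n.+1, mxip v v = 1 &
    forall w : 'rV[R]_n.+1, mxnrm (w *m A) <= mxnrm (v *m A) * mxnrm w.
Proof.
pose S : set 'rV[R]_n.+1 := [set v | mxip v v = 1].
have cS : compact S.
  apply: bounded_closed_compact.
    exists 1; split => // x x1 v /= Sv; apply: le_trans (ltW x1).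
    rewrite [leLHS]/Num.Def.normr /= mx_normrE; apply: bigmax_le => // -[i j] _ /=.
    rewrite -(@ler_pXn2r _ 2) // ?nnegrE // real_normK ?num_real // expr1n -Sv /mxip.
    rewrite (bigD1 i) //= (bigD1 j) //= -expr2 -addrA lerDl addr_ge0 //.
      by apply: sumr_ge0 => k _; rewrite -expr2 sqr_ge0.
    by apply: sumr_ge0 => k _; apply: sumr_ge0 => l _; rewrite -expr2 sqr_ge0.
  have -> : S = (fun v : 'rV[R]_n.+1 => mxip (v *m 1%:M) (v *m 1%:M)) @^-1` [set x | x = 1].
    by apply/seteqP; split => v /=; rewrite mulmx1.
  apply: preimage_closed; last exact: closed_eq.
  by move=> v _; exact: continuous_mxip_mulmx.
have S0 : S !=set0.
  exists (delta_mx 0 0); rewrite /S /= /mxip big_ord1 (bigD1 0) //= !mxE !eqxx mulr1.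
  rewrite big1 ?addr0 // => i i0; rewrite !mxE (negbTE i0) andbF mulr0 //.
have [v vS vmax] := @EVT_max_rV R _ (fun v => mxip (v *m A) (v *m A)) S S0 cS
  (continuous_subspaceT (@continuous_mxip_mulmx _ _ A)).
exists v; first by move: vS; rewrite inE.
move=> w; have [->|w0] := eqVneq w 0; first by rewrite mul0mx !mxnrm0 mulr0.
have wp : 0 < mxnrm w by rewrite mxnrm_gt0.
have /vmax : (mxnrm w)^-1 *: w \in S.
  by rewrite inE /S /= mxipZl mxipZr -sqr_mxnrm; field; rewrite gt_eqF.
rewrite -mxnrm_le -scalemxAl mxnrmZ ger0_norm ?invr_ge0 ?mxnrm_ge0 //.
by rewrite mulrC ler_pdivrMr.
Qed.

(* The Householder reflection exchanging [u] and the first basis vector. *)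
Lemma exists_orthogonal_first_row n (u : 'rV[R]_n.+1) :
  mxip u u = 1 ->
  exists2 Q : 'M[R]_n.+1, Q *m Q^T = 1%:M & delta_mx 0 0 *m Q = u.
Proof.
move=> u1; pose e : 'rV[R]_n.+1 := delta_mx 0 0.
have [<-|ne] := eqVneq e u; first by exists 1%:M; rewrite ?trmx1 mulmx1.
pose w := e - u; pose c := 2 / mxip w w.
have w0 : mxip w w != 0 by rewrite mxip_eq0 subr_eq0.
have sc (x y : 'rV[R]_n.+1) : x *m y^T = (mxip x y)%:M.
  by rewrite mxipC mxipE mxtrace_mulC trace_mx11 -mx11_scalar.
have e1 : mxip e e = 1.
  rewrite /mxip big_ord1 (bigD1 0) //= !mxE !eqxx mulr1.
  rewrite big1 ?addr0 // => i i0; rewrite !mxE (negbTE i0) andbF mulr0 //.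
have QT : (1%:M - c *: (w^T *m w))^T = 1%:M - c *: (w^T *m w).
  by rewrite raddfB /= trmx1 linearZ /= trmx_mul trmxK.
exists (1%:M - c *: (w^T *m w)).
  rewrite QT.
  rewrite mulmxBr mulmx1 mulmxBl mul1mx -scalemxAl -scalemxAr.
  rewrite mulmxA -(mulmxA w^T) sc mul_mx_scalar -scalemxAl 2!scalerA.
  have -> : c * (c * mxip w w) = c + c by rewrite /c; field.
  by rewrite scalerDl opprB addrK subrK.
rewrite -/e mulmxBr mulmx1 -scalemxAr mulmxA sc mul_scalar_mx scalerA.
have -> : c * mxip e w = 1.
  (* Both [e] and [u] are unit vectors, so |e - u|^2 = 2 - 2 <e, u>. *)
  have -> : mxip e w = mxip w w / 2.
    by rewrite /w !mxip_lin u1 e1 (mxipC u e); field.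
  by rewrite /c; field.
by rewrite scale1r /w opprB addrC subrK.
Qed.

Lemma mxnrm_delta k (j : 'I_k) : mxnrm (delta_mx 0 j : 'rV[R]_k) = 1.
Proof.
rewrite /mxnrm /mxip big_ord1 (bigD1 j) //= !mxE !eqxx mulr1.
rewrite big1 ?addr0 ?sqrtr1 // => i i0; rewrite !mxE (negbTE i0) andbF mulr0 //.
Qed.

Lemma mxip_row_mx p q k (A C : 'M[R]_(p, q)) (B D : 'M[R]_(p, k)) :
  mxip (row_mx A B) (row_mx C D) = mxip A C + mxip B D.
Proof. by rewrite !mxipE tr_row_mx mul_col_row mxtrace_block. Qed.

(** The i-th row of [U^T] is a unit vector whose image under [A] has length [s 0 i]. *)
Lemma svd_le_bound n (A U V : 'M[R]_n) s c :
  is_svd A U s V -> (forall w : 'rV[R]_n, mxnrm (w *m A) <= c * mxnrm w) ->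
  forall i, s 0 i <= c.
Proof.
move=> [UU VV s0 _ ->] h i; have := h (delta_mx 0 i *m U^T).
rewrite mxnrm_orthoR // mxnrm_delta mulr1 !mulmxA mxnrm_orthoR //.
rewrite -(mulmxA _ U^T U) UU mulmx1 -rowE row_diag_mx mxnrmZ mxnrm_delta mulr1.
by rewrite ger0_norm.
Qed.

(** Deflation: a unit row [v] maximizing |v A| and its normalized image [u] are a leading singular
    pair. In orthonormal bases beginning with [v] and [u] the matrix is block diagonal, and the
    induction hypothesis treats the lower block. *)
Theorem exists_svd n (A : 'M[R]_n) :
  exists (U : 'M[R]_n) s (V : 'M[R]_n), is_svd A U s V.
Proof.
elim: n A => [|n IH] A.
  by exists 1%:M, 0, 1%:M; split; rewrite ?trmx1 ?mulmx1 //;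
     [move=> [] | move=> [] | apply/matrixP => -[]].
have [v v1 vmax] := exists_max_unit_row A.
set s1 := mxnrm (v *m A) in vmax.
have s1_ge0 : 0 <= s1 by exact: mxnrm_ge0.
have [s10|s10] := eqVneq s1 0.
  have -> : A = 0.
    apply/row_matrixP => i; rewrite row0 rowE; apply/eqP.
    by rewrite -mxnrm_eq0 eq_le mxnrm_ge0 andbT (le_trans (vmax _)) // s10 mul0r.
  exists 1%:M, 0, 1%:M; split; rewrite ?trmx1 ?mulmx1 //.
  - by move=> i; rewrite mxE.
  - by move=> i j _; rewrite !mxE.
  - by rewrite mul1mx; apply/matrixP => i j; rewrite !mxE mul0rn.
have s1p : 0 < s1 by rewrite lt_def s10.
pose u := s1^-1 *: (v *m A).
have vA : v *m A = s1 *: u by rewrite /u scalerA divff // scale1r.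
have u1 : mxip u u = 1.
  by rewrite /u mxipZl mxipZr -sqr_mxnrm -/s1; field.
(* Since <u A^T, v> = s1, one has |u A^T - s1 v|^2 = |u A^T|^2 - s1^2, and maximality of [s1],
   tested on the row [u A^T], makes this nonpositive. *)
have uA : u *m A^T = s1 *: v.
  apply/eqP; rewrite -subr_eq0 -mxip_eq0 eq_le mxip_ge0 andbT.
  have vu : mxip (u *m A^T) v = s1.
    by rewrite mxip_mulmxr trmxK vA mxipZr u1 mulr1.
  rewrite !mxip_lin (mxipC v) vu v1.
  have : mxnrm (u *m A^T) <= s1.
    have [z|z] := eqVneq (mxnrm (u *m A^T)) 0; first by rewrite z.
    have zp : 0 < mxnrm (u *m A^T) by rewrite lt_def z mxnrm_ge0.
    rewrite -(ler_pM2r zp) -expr2 sqr_mxnrm mxip_mulmxr trmxK.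
    apply: le_trans (mxip_le _ _) _; rewrite {1}/mxnrm u1 sqrtr1 mul1r.
    exact: vmax.
  rewrite mxnrm_le_sqr //; lra.
have [Q QQ Qv] := exists_orthogonal_first_row v1.
have [Q' QQ' Qu] := exists_orthogonal_first_row u1.
have QtQ := mulmx1C QQ; have QtQ' := mulmx1C QQ'.
pose B : 'M[R]_(1 + n) := Q *m A *m Q'^T.
have BA : A = Q^T *m B *m Q'.
  by rewrite /B !mulmxA QtQ mul1mx -mulmxA QtQ' mulmx1.
have rB : delta_mx 0 0 *m B = s1 *: (delta_mx 0 0 : 'rV[R]_(1 + n)).
  by rewrite /B !mulmxA Qv vA -Qu -!scalemxAl -mulmxA QQ' mulmx1.
have cB : delta_mx 0 0 *m B^T = s1 *: (delta_mx 0 0 : 'rV[R]_(1 + n)).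
  rewrite /B !trmx_mul trmxK !mulmxA Qu uA -Qv -!scalemxAl -mulmxA QQ mulmx1 //.
have QAQ : Q *m A *m Q'^T = B by [].
move: B BA rB cB QAQ => B BA rB cB QAQ.
have Bblk : B = block_mx s1%:M 0 0 (drsubmx B).
  rewrite -[LHS]submxK; congr block_mx.
  - apply/matrixP => i j; rewrite !ord1 !mxE eqxx mulr1n.
    have := congr1 (fun M : 'rV[R]_(1 + n) => M 0 0) rB.
    by rewrite -rowE !mxE eqxx mulr1 => <-; congr (B _ _); apply/val_inj.
  - apply/matrixP => i j; rewrite !ord1 !mxE.
    have := congr1 (fun M : 'rV[R]_(1 + n) => M 0 (rshift 1 j)) rB.
    by rewrite -rowE !mxE /= mulr0 => <-; congr (B _ _); apply/val_inj.
  - apply/matrixP => i j; rewrite !ord1 !mxE.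
    have := congr1 (fun M : 'rV[R]_(1 + n) => M 0 (rshift 1 i)) cB.
    by rewrite -rowE !mxE /= mulr0 => <-; congr (B _ _); apply/val_inj.
have [U' [s' [V' svd']]] := IH (drsubmx B).
(* The ordering of the singular values: a row padded with a leading zero meets only the lower block,
   so maximality of [s1] bounds that block too. *)
have s's1 : forall j, s' 0 j <= s1.
  apply: (svd_le_bound svd') => w'.
  pose w : 'rV[R]_n.+1 := row_mx (0 : 'rV[R]_1) w'.
  have nw (x : 'rV[R]_n) : @mxnrm R 1 n.+1 (row_mx (0 : 'rV[R]_1) x) = mxnrm x.
    have := @mxip_row_mx 1 1 n 0 0 x x; rewrite mxip0l add0r /mxnrm => <- //.
  have wB : w *m B = row_mx (0 : 'rV[R]_1) (w' *m drsubmx B).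
    have := mul_row_block (0 : 'rV[R]_1) w' s1%:M 0 0 (drsubmx B).
    by rewrite -Bblk !mul0mx !mulmx0 !add0r.
  rewrite -[mxnrm w']nw -/w.
  have -> : mxnrm (w' *m drsubmx B) = mxnrm ((w *m Q) *m A).
    rewrite -(mxnrm_orthoR (V := Q') _ QtQ') -!mulmxA (mulmxA Q) QAQ wB.
    by rewrite nw.
  apply: le_trans (vmax _) _.
  by rewrite -[X in _ *m X]trmxK mxnrm_orthoR // trmxK.
have [UU' VV' s'0 s'le Beq] := svd'.
pose bl (W : 'M[R]_n) : 'M[R]_(1 + n) := block_mx 1%:M 0 0 W.
have blk1 (W : 'M[R]_n) : W^T *m W = 1%:M -> (bl W)^T *m bl W = 1%:M.
  move=> WW; rewrite /bl tr_block_mx mulmx_block !trmx0 trmx1 !mulmx0 !mul0mx WW.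
  by rewrite mulmx1 !addr0 !add0r -scalar_mx_block.
pose d : 'rV[R]_(1 + n) := row_mx s1%:M s'.
have Bsvd : B = bl U' *m diag_mx d *m (bl V')^T.
  rewrite Bblk /bl /d diag_mx_row tr_block_mx !mulmx_block !trmx0 trmx1.
  rewrite !(mulmx0, mul0mx, addr0, add0r, mul1mx, mulmx1) -Beq.
  by congr block_mx; apply/matrixP => i j; rewrite !ord1 !mxE ?eqxx.
have d_ge0 i : 0 <= d 0 i.
  rewrite /d; case: (split_ordP i) => k ->.
    by rewrite row_mxEl ord1 mxE eqxx mulr1n.
  by rewrite row_mxEr.
have d_le (i j : 'I_(1 + n)) : (i <= j)%N -> d 0 j <= d 0 i.
  rewrite /d; case: (split_ordP i) => k ->; case: (split_ordP j) => l ->;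
    rewrite ?row_mxEl ?row_mxEr ?ord1 ?mxE ?eqxx ?mulr1n //.
  by rewrite leq_add2l; exact: s'le.
exists (Q^T *m (bl U' : 'M[R]_n.+1)), d, (Q'^T *m (bl V' : 'M[R]_n.+1)); split.
- by rewrite trmx_mul trmxK mulmxA -(mulmxA _ Q) QQ mulmx1 blk1.
- by rewrite trmx_mul trmxK mulmxA -(mulmxA _ Q') QQ' mulmx1 blk1.
- exact: d_ge0.
- exact: d_le.
- by rewrite trmx_mul trmxK !mulmxA {1}BA Bsvd !mulmxA.
Qed.

End SVDExistence.

(** * Reduced singular value decompositions and the smallest positive singular value *)

Section ReducedSVD.
Variable R : realType.

Lemma mxnrm_mul_diag_ge p k (A : 'M[R]_(p, k)) (d : 'rV[R]_k) c :
  0 <= c -> (forall i, c <= d 0 i) -> c * mxnrm A <= mxnrm (A *m diag_mx d).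
Proof.
move=> c0 cd; rewrite -(ger0_norm c0) -mxnrmZ mxnrm_le.
apply: ler_sum => i _; apply: ler_sum => j _; rewrite mul_mx_diag !mxE -!expr2 !exprMn.
by rewrite mulrC ler_wpM2l ?sqr_ge0 // ler_sqr ?nnegrE // (le_trans c0).
Qed.

Lemma svdE n k (U V : 'M[R]_(n, k)) (s : 'rV[R]_k) i j :
  (U *m diag_mx s *m V^T) i j = \sum_l U i l * s 0 l * V j l.
Proof. by rewrite mul_mx_diag mxE; apply: eq_bigr => l _; rewrite !mxE. Qed.

Lemma svd_narrow n k (kn : (k <= n)%N) (U V : 'M[R]_n) (s : 'rV[R]_n) :
  (forall i : 'I_n, (k <= i)%N -> s 0 i = 0) ->
  U *m diag_mx s *m V^T =
  colsub (widen_ord kn) U *m diag_mx (colsub (widen_ord kn) s) *m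
    (colsub (widen_ord kn) V)^T.
Proof.
move=> s0; apply/matrixP => i j; rewrite !svdE.
rewrite (bigID (fun l : 'I_n => l < k)%N) /= [X in _ + X]big1 ?addr0; last first.
  by move=> l; rewrite -leqNgt => /s0 ->; rewrite mulr0 mul0r.
by rewrite (big_ord_narrow kn); apply: eq_bigr => l _; rewrite !mxE.
Qed.

Lemma colsub_ortho n k (kn : (k <= n)%N) (U : 'M[R]_n) :
  U^T *m U = 1%:M -> (colsub (widen_ord kn) U)^T *m colsub (widen_ord kn) U = 1%:M.
Proof.
move=> UU; apply/matrixP => i j.
have := congr1 (fun M : 'M[R]_n => M (widen_ord kn i) (widen_ord kn j)) UU.
rewrite !mxE => h; rewrite -[RHS]/((i == j)%:R) -[i == j]/(widen_ord kn i == widen_ord kn j) -h.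
by apply: eq_bigr => l _; rewrite !mxE.
Qed.

(** By monotonicity the positive singular values occupy an initial segment of the indices; [k] is
    the least index from which all vanish. *)
Lemma svd_positive_index n (A U V : 'M[R]_n) s : is_svd A U s V ->
  exists2 k, (k <= n)%N & forall i, (0 < s 0 i) = (i < k)%N.
Proof.
move=> [_ _ s0 sle _].
pose P k := [forall i : 'I_n, (k <= i)%N ==> (s 0 i == 0)].
have exP : exists k, P k.
  by exists n; apply/forallP => i; apply/implyP; rewrite leqNgt ltn_ord.
case: (ex_minnP exP) => k /forallP Pk kmin.
exists k.
  by apply: kmin; apply/forallP => i; apply/implyP; rewrite leqNgt ltn_ord.
move=> i; case: (ltnP i k) => ik.
  have : ~~ P i by apply/negP => /kmin; rewrite leqNgt ik.
  rewrite negb_forall => /existsP[j]; rewrite negb_imply => /andP[ij sj].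
  by apply: lt_le_trans (sle _ _ ij); rewrite lt_def sj s0.
by have := Pk i; rewrite ik => /eqP ->; rewrite ltxx.
Qed.

Lemma reduced_svd_rank n r (A : 'M[R]_n) (U V : 'M[R]_(n, r)) s :
  is_reduced_svd A U s V -> \rank A = r.
Proof.
move=> [[UU VV _ _ AE] sp]; apply/eqP; rewrite eqn_leq; apply/andP; split.
  by rewrite AE -mulmxA (leq_trans (mxrankM_maxl _ _)) // rank_leq_col.
have DA : diag_mx s = U^T *m A *m V.
  by rewrite AE !mulmxA UU mul1mx -mulmxA VV mulmx1.
have <- : \rank (diag_mx s) = r.
  apply: mxrank_unit; rewrite unitmxE det_diag unitfE.
  by apply/prodf_neq0 => i _; rewrite gt_eqF.
by rewrite DA (leq_trans (mxrankM_maxl _ _)) // mxrankM_maxr.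
Qed.

Lemma reduced_svd_of_svd n (A U V : 'M[R]_n) s :
  is_svd A U s V ->
  exists kn : (\rank A <= n)%N, is_reduced_svd A (colsub (widen_ord kn) U)
     (colsub (widen_ord kn) s) (colsub (widen_ord kn) V).
Proof.
move=> svdA; have [k kn sk] := svd_positive_index svdA.
have [UU VV s0 sle AE] := svdA.
have red : is_reduced_svd A (colsub (widen_ord kn) U)
     (colsub (widen_ord kn) s) (colsub (widen_ord kn) V).
  split; last by move=> i; rewrite mxE sk; exact: (ltn_ord i).
  split; rewrite ?colsub_ortho //.
  - by move=> i; rewrite mxE.
  - by move=> i j ij; rewrite !mxE sle.
  rewrite -svd_narrow // => i ki; apply/eqP.
  by rewrite eq_le s0 andbT leNgt sk -leqNgt.
have kr : k = \rank A by rewrite (reduced_svd_rank red).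
by case: _ / kr kn {sk} red => kn red; exists kn.
Qed.

Lemma reduced_svd_tr n r (A : 'M[R]_n) (U V : 'M[R]_(n, r)) s :
  is_reduced_svd A U s V -> is_reduced_svd A^T V s U.
Proof.
move=> [[UU VV s0 sle AE] sp]; split => //; split => //.
by rewrite AE !trmx_mul trmxK tr_diag_mx mulmxA.
Qed.

(** [sigma_min] is an infimum over all SVDs, so its positivity requires comparing an arbitrary SVD
    with a fixed reduced one. The condition [0 < r] makes the set nonempty. *)
Lemma sigma_min_reduced_svd n r (X : 'M[R]_n) : \rank X = r -> (0 < r)%N ->
  exists (U : 'M[R]_(n, r)) s (V : 'M[R]_(n, r)),
  [/\ is_reduced_svd X U s V, 0 < sigma_min X & forall i, sigma_min X <= s 0 i].
Proof.
move=> Xr r0; have [U [s [V svdX]]] := exists_svd X.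
have [] := reduced_svd_of_svd svdX; rewrite Xr => kn red.
set U1 := colsub _ U in red; set V1 := colsub _ V in red; set s1 := colsub _ s in red.
have [[UU1 VV1 s10 s1le XE] s1p] := red.
exists U1, s1, V1; split => //.
  have [r' rE] : exists r', r = r'.+1 by case: (r) r0 => // r' _; exists r'.
  pose j := Ordinal (leqnn r'.+1); pose j0 := cast_ord (esym rE) j.
  apply: lt_le_trans (s1p j0) _; apply: lb_le_inf.
    exists (s1 0 j0); split => //; exists U, s, V; split => //.
    by exists (widen_ord kn j0); rewrite mxE.
  move=> x [x0 [U2 [s2 [V2 [[UU2 VV2 s20 s2le XE2] [i xi]]]]]].
  pose w : 'rV[R]_n := delta_mx 0 i *m U2^T.
  pose y : 'rV[R]_n := delta_mx 0 i *m V2^T.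
  have wX : w *m X = x *: y.
    rewrite /w /y XE2 !mulmxA -(mulmxA _ U2^T) UU2 mulmx1 -rowE row_diag_mx.
    by rewrite -xi scalemxAl.
  have yX : y *m X^T = x *: w.
    rewrite /w /y XE2 !trmx_mul trmxK tr_diag_mx !mulmxA -(mulmxA _ V2^T) VV2 mulmx1.
    by rewrite -rowE row_diag_mx -xi scalemxAl.
  (* As [x] is nonzero, [w] is a multiple of [y X^T], hence lies in the row space of [U1^T]; there
     [X] stretches by at least the last entry of [s1]. *)
  have wU : w *m U1 *m U1^T = w.
    apply: (scalerI (lt0r_neq0 x0)); rewrite (scalemxAl x (w *m U1)) (scalemxAl x w).
    rewrite -yX XE !trmx_mul trmxK.
    by rewrite !mulmxA -(mulmxA _ U1^T) UU1 mulmx1.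
  have nx : mxnrm (w *m X) = x.
    by rewrite wX mxnrmZ mxnrm_orthoR // mxnrm_delta mulr1 gtr0_norm.
  rewrite -nx XE !mulmxA mxnrm_orthoR //.
  apply: le_trans (mxnrm_mul_diag_ge (c := s1 0 j0) _ _ _) => //.
    by rewrite -(mxnrm_orthoR _ UU1) wU mxnrm_orthoR // mxnrm_delta mulr1.
  by move=> l; apply: s1le; rewrite /= -ltnS -rE.
move=> i; apply: ge_inf; first by exists 0 => x [/ltW].
by split => //; exists U, s, V; split => //; exists (widen_ord kn i); rewrite mxE.
Qed.

End ReducedSVD.

(** * Tangent projections and perturbation of singular subspaces *)

Section TangentSpace.
Variable R : realType.

(** The lock keeps this projector an atom in long matrix products. *)
Definition compl_proj n r (U : 'M[R]_(n, r)) : 'M[R]_n :=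
  locked (1%:M - U *m U^T).

Lemma compl_projE n r (U : 'M[R]_(n, r)) : compl_proj U = 1%:M - U *m U^T.
Proof. by rewrite /compl_proj -lock. Qed.

Lemma compl_proj_tr n r (U : 'M[R]_(n, r)) : (compl_proj U)^T = compl_proj U.
Proof. by rewrite compl_projE raddfB /= trmx1 trmx_mul trmxK. Qed.

Lemma compl_projU n r (U : 'M[R]_(n, r)) : U^T *m U = 1%:M -> compl_proj U *m U = 0.
Proof. by move=> UU; rewrite compl_projE mulmxBl mul1mx -mulmxA UU mulmx1 subrr. Qed.

Lemma compl_projUT n r (U : 'M[R]_(n, r)) : U^T *m U = 1%:M -> U^T *m compl_proj U = 0.
Proof. by move=> UU; rewrite -[LHS]trmxK trmx_mul trmxK compl_proj_tr compl_projU ?trmx0. Qed.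

Lemma compl_proj_idem n r (U : 'M[R]_(n, r)) : U^T *m U = 1%:M ->
  compl_proj U *m compl_proj U = compl_proj U.
Proof. by move=> UU; rewrite {2}compl_projE mulmxBr mulmx1 mulmxA compl_projU // mul0mx subr0. Qed.

Lemma compl_proj_pyth n r q (U : 'M[R]_(n, r)) (Z : 'M[R]_(n, q)) : U^T *m U = 1%:M ->
  mxip Z Z = mxip (U^T *m Z) (U^T *m Z) + mxip (compl_proj U *m Z) (compl_proj U *m Z).
Proof.
move=> UU; rewrite (mxip_mulmxl (compl_proj U)) compl_proj_tr mulmxA compl_proj_idem //.
by rewrite compl_projE mulmxBl mul1mx mxip_lin mxipNr mxip_mulmxl trmxK mulmxA addrC subrK.
Qed.

Lemma mxnrm_compl_proj n r q (U : 'M[R]_(n, r)) (Z : 'M[R]_(n, q)) : U^T *m U = 1%:M ->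
  mxnrm (compl_proj U *m Z) <= mxnrm Z.
Proof. by move=> UU; rewrite mxnrm_le (compl_proj_pyth Z UU) lerDr mxip_ge0. Qed.

Lemma mxnrm_orthoT n r q (U : 'M[R]_(n, r)) (Z : 'M[R]_(n, q)) : U^T *m U = 1%:M ->
  mxnrm (U^T *m Z) <= mxnrm Z.
Proof. by move=> UU; rewrite mxnrm_le (compl_proj_pyth Z UU) lerDl mxip_ge0. Qed.

Lemma mxnrm_compl_projr n r q (U : 'M[R]_(n, r)) (Z : 'M[R]_(q, n)) : U^T *m U = 1%:M ->
  mxnrm (Z *m compl_proj U) <= mxnrm Z.
Proof.
by move=> UU; rewrite -mxnrm_tr trmx_mul compl_proj_tr -(mxnrm_tr Z) mxnrm_compl_proj.
Qed.

(** Equal to U U^T Z + Z V V^T - U U^T Z V V^T; in the present form the normal component is a single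
    product. *)
Definition tproj n r (U V : 'M[R]_(n, r)) (Z : 'M[R]_n) : 'M[R]_n :=
  Z - compl_proj U *m Z *m compl_proj V.

(** [U' = Y V' S'^-1], with [S'] the diagonal of [s'], has its columns in the range of [Y], on which
    [U U^T] is the identity. *)
Lemma reduced_svd_colspace n r (Y : 'M[R]_n) (U V U' V' : 'M[R]_(n, r)) s s' :
  is_reduced_svd Y U s V -> is_reduced_svd Y U' s' V' -> U *m U^T *m U' = U'.
Proof.
move=> [[UU VV _ _ YE] sp] [[UU' VV' _ _ YE'] sp'].
have Du : diag_mx s' \in unitmx.
  by rewrite unitmxE det_diag unitfE; apply/prodf_neq0 => i _; rewrite gt_eqF.
have <- : Y *m V' *m invmx (diag_mx s') = U'.
  by rewrite YE' -(mulmxA _ V'^T) VV' mulmx1 mulmxK.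
by rewrite YE !mulmxA -(mulmxA U) UU mulmx1.
Qed.

(** Turns the existential over reduced SVDs into one linear equation for a fixed SVD. *)
Lemma tangent_spaceP n r (Y W : 'M[R]_n) (U V : 'M[R]_(n, r)) s :
  is_reduced_svd Y U s V ->
  tangent_space r Y W <-> compl_proj U *m W *m compl_proj V = 0.
Proof.
move=> red; split.
  move=> [U' [s' [V' [red' [Z1 [Z2 ->]]]]]].
  have eU := reduced_svd_colspace red red'.
  have eV := reduced_svd_colspace (reduced_svd_tr red) (reduced_svd_tr red').
  have -> : compl_proj U *m (U' *m Z1^T + Z2 *m V'^T) = compl_proj U *m Z2 *m V'^T.
    by rewrite mulmxDr !mulmxA {1}compl_projE mulmxBl mul1mx eU subrr mul0mx add0r.
  rewrite -mulmxA.
  have -> : V'^T *m compl_proj V = 0; last by rewrite mulmx0.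
  by rewrite -[LHS]trmxK trmx_mul trmxK compl_proj_tr compl_projE mulmxBl mul1mx eV subrr trmx0.
move=> h; exists U, s, V; split => //.
exists (W^T *m U), (compl_proj U *m W *m V).
rewrite trmx_mul trmxK mulmxA.
have -> : compl_proj U *m W *m V *m V^T = compl_proj U *m W.
  move: h; rewrite (compl_projE V) mulmxBr mulmx1 mulmxA => /eqP.
  by rewrite subr_eq0 => /eqP <-.
by rewrite compl_projE mulmxBl mul1mx addrC subrK.
Qed.

Lemma mxip_mul2 n (A B Z W : 'M[R]_n) : A^T = A -> B^T = B ->
  mxip (A *m Z *m B) W = mxip Z (A *m W *m B).
Proof. by move=> AT BT; rewrite mxip_mulmxr BT mxip_mulmxl AT mulmxA. Qed.

Lemma orth_proj_tangentE n r (Y Z : 'M[R]_n) (U V : 'M[R]_(n, r)) s :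
  is_reduced_svd Y U s V -> orth_proj (tangent_space r Y) Z = tproj U V Z.
Proof.
move=> red; have [[UU VV _ _ _] _] := red.
have Tt W : tangent_space r Y W <-> compl_proj U *m W *m compl_proj V = 0.
  exact: tangent_spaceP red.
have idem A : compl_proj U *m (compl_proj U *m A *m compl_proj V) *m compl_proj V =
  compl_proj U *m A *m compl_proj V.
  by rewrite !mulmxA compl_proj_idem // -!mulmxA compl_proj_idem.
have PT A : compl_proj U *m tproj U V A *m compl_proj V = 0.
  by rewrite /tproj mulmxBr [LHS]mulmxBl idem subrr.
(* [tproj] itself rules out the default value of [xget]; for the chosen [W], the difference with
   [tproj] is tangent and orthogonal to itself. *)
rewrite /orth_proj; case: xgetP => [W WE [TW Worth]|/(_ (tproj U V Z)) []]; last first.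
  split; first by apply/Tt.
  move=> W' /Tt TW'; rewrite /tproj subKr.
  by rewrite [LHS]mxip_mul2 ?compl_proj_tr // TW' mxip0r.
apply/eqP; rewrite -subr_eq0 -mxip_eq0.
have TP : tangent_space r Y (W - tproj U V Z).
  by apply/Tt; rewrite mulmxBr [LHS]mulmxBl PT (Tt _).1 // subrr.
have h1 := Worth _ TP.
have h2 : mxip (Z - tproj U V Z) (W - tproj U V Z) = 0.
  by rewrite {1}/tproj subKr mxip_mul2 ?compl_proj_tr // (Tt _).1 // mxip0r.
have {1}-> : W - tproj U V Z = (Z - tproj U V Z) - (Z - W).
  by move: (tproj U V Z) => T; rewrite opprB [RHS]addrC addrA subrK.
by rewrite mxipDl mxipNl h2 [mxip (Z - W) _]h1 subrr.
Qed.

Definition orthogonal_projector n (P : 'M[R]_n -> 'M[R]_n) : Prop :=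
  [/\ forall a A B, P (a *: A + B) = a *: P A + P B,
      forall A B, mxip (P A) B = mxip A (P B) &
      forall A, P (P A) = P A].

Lemma tproj_orthogonal_projector n r (U V : 'M[R]_(n, r)) :
  U^T *m U = 1%:M -> V^T *m V = 1%:M -> orthogonal_projector (tproj U V).
Proof.
move=> UU VV; split.
- move=> a A B; rewrite /tproj mulmxDr mulmxDl -scalemxAr -scalemxAl.
  by rewrite scalerBr opprD addrACA.
- by move=> A B; rewrite /tproj mxipDl mxipNl mxip_mul2 ?compl_proj_tr // mxipDr mxipNr.
- move=> A; rewrite {1}/tproj; apply/eqP; rewrite subr_eq addrC -subr_eq subrr eq_sym.
  rewrite mulmxBr [X in X == _]mulmxBl !mulmxA compl_proj_idem //.
  by rewrite -!mulmxA compl_proj_idem // subrr.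
Qed.

Section Perturbation.
Variables (n r : nat) (X Y : 'M[R]_n) (U V U' V' : 'M[R]_(n, r)) (s s' : 'rV[R]_r).
Variable sigma : R.
Hypothesis redX : is_reduced_svd X U s V.
Hypothesis redY : is_reduced_svd Y U' s' V'.
Hypothesis sigma_gt0 : 0 < sigma.
Hypothesis sigma_le : forall i, sigma <= s 0 i.
Let d := mxnrm (Y - X) / sigma.

(** Write [U a = X V b] with |b| <= |a| / sigma; the complement of [U'] annihilates [Y], so [X] may
    be replaced by [X - Y]. *)
Lemma compl_proj_perturb q (a : 'M[R]_(r, q)) :
  mxnrm (compl_proj U' *m (U *m a)) <= d * mxnrm a.
Proof.
have [[UU VV _ _ XE] sp] := redX; have [[UU' _ _ _ YE] _] := redY.
have Du : diag_mx s \in unitmx.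
  by rewrite unitmxE det_diag unitfE; apply/prodf_neq0 => i _; rewrite gt_eqF.
pose b := invmx (diag_mx s) *m a.
have nb : mxnrm b <= mxnrm a / sigma.
  rewrite ler_pdivlMr // mulrC -(mxnrm_tr b).
  apply: le_trans (mxnrm_mul_diag_ge _ (ltW sigma_gt0) sigma_le) _.
  by rewrite -mxnrm_tr trmx_mul trmxK tr_diag_mx /b mulKVmx.
have -> : compl_proj U' *m (U *m a) = compl_proj U' *m ((X - Y) *m (V *m b)).
  rewrite mulmxBl mulmxBr YE !mulmxA compl_projU // !mul0mx subr0 XE.
  by rewrite -!mulmxA (mulmxA V^T) VV mul1mx mulKVmx.
apply: le_trans (mxnrm_compl_proj _ UU') _; apply: le_trans (mxnrm_mul _ _) _.
rewrite mxnrm_orthoL // mxnrm_distC /d -mulrA ler_wpM2l ?mxnrm_ge0 // mulrC //.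
Qed.

Hypothesis d_lt1 : d < 1.

Let d_ge0 : 0 <= d. Proof. by rewrite divr_ge0 ?mxnrm_ge0 // ltW. Qed.

Let dn_ge0 p q (A : 'M[R]_(p, q)) : 0 <= d * mxnrm A.
Proof. exact: mulr_ge0 d_ge0 (mxnrm_ge0 _). Qed.

(* The spaces have equal dimension, so [U'^T U] is square and a lower bound for it
   is also one for its transpose. *)
Lemma compl_proj_perturb_sym q (b : 'M[R]_(r, q)) :
  mxnrm (compl_proj U *m (U' *m b)) <= d * mxnrm b.
Proof.
have [[UU _ _ _ _] _] := redX; have [[UU' _ _ _ _] _] := redY.
have d2 : 0 < 1 - d ^+ 2 by have := d_ge0; have := d_lt1; nra.
pose M := U'^T *m U.
have lowM k (a : 'M[R]_(r, k)) : (1 - d ^+ 2) * mxip a a <= mxip (M *m a) (M *m a).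
  have := compl_proj_perturb a; rewrite mxnrm_le_sqr ?dn_ge0 //.
  have := compl_proj_pyth (U *m a) UU'; rewrite mxip_orthoL // exprMn sqr_mxnrm.
  rewrite mulmxA -/M; lra.
have Mu : M \in unitmx.
  rewrite -unitmx_tr -row_free_unit -kermx_eq0.
  have := lowM _ (kermx M^T)^T.
  have -> : M *m (kermx M^T)^T = 0.
    by rewrite -[LHS]trmxK trmx_mul trmxK mulmx_ker trmx0.
  rewrite mxip0l pmulr_rle0 // mxip_tr => h.
  by rewrite -mxip_eq0 eq_le h mxip_ge0.
(* With [b = M a], Cauchy-Schwarz on <b, b> = <a, M^T b> combines with the lower bound for [M] at
   [a]. *)
have lowMT : (1 - d ^+ 2) * mxip b b <= mxip (M^T *m b) (M^T *m b).
  pose a := invmx M *m b; have Ma : M *m a = b by rewrite /a mulKVmx.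
  have [b0|b0] := eqVneq (mxip b b) 0.
    by rewrite b0 mulr0 mxip_ge0.
  have bp : 0 < mxip b b by rewrite lt_def b0 mxip_ge0.
  have h1 := lowM _ a; rewrite Ma in h1.
  have h2 : mxip b b ^+ 2 <= mxip a a * mxip (M^T *m b) (M^T *m b).
    by rewrite -{1}Ma mxip_mulmxl mxip_sqr_le.
  have h3 := mxip_ge0 (M^T *m b).
  rewrite -(ler_pM2l bp); nra.
have := compl_proj_pyth (U' *m b) UU; rewrite mxip_orthoL //.
rewrite mulmxA -[U^T *m U']trmxK trmx_mul trmxK -/M => h.
rewrite mxnrm_le_sqr ?dn_ge0 // exprMn sqr_mxnrm; lra.
Qed.

(** The difference splits into two mutually orthogonal pieces that act on the two orthogonal
    components of [Z], so the bounds add in squares and the constant is [d], not [2 d]. *)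
Lemma proj_perturb q (Z : 'M[R]_(n, q)) :
  mxnrm ((U' *m U'^T - U *m U^T) *m Z) <= d * mxnrm Z.
Proof.
have [[UU _ _ _ _] _] := redX; have [[UU' _ _ _ _] _] := redY.
pose b := U'^T *m (compl_proj U *m Z).
pose c := compl_proj U' *m (U *m (U^T *m Z)).
have -> : (U' *m U'^T - U *m U^T) *m Z = U' *m b - c.
  rewrite /b /c !compl_projE !mulmxBl !mul1mx !mulmxBr !mulmxA.
  by rewrite opprB addrA subrK.
have Uc : U'^T *m c = 0 by rewrite /c mulmxA compl_projUT // mul0mx.
have nc : mxip c c <= d ^+ 2 * mxip (U^T *m Z) (U^T *m Z).
  have := compl_proj_perturb (U^T *m Z); rewrite mxnrm_le_sqr ?dn_ge0 //.
  by rewrite exprMn sqr_mxnrm.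
have nb : mxip b b <= d ^+ 2 * mxip (compl_proj U *m Z) (compl_proj U *m Z).
  have [b0|b0] := eqVneq b 0; first by rewrite b0 mxip0l mulr_ge0 ?sqr_ge0 ?mxip_ge0.
  have bp : 0 < mxnrm b by rewrite mxnrm_gt0.
  (* Duality: the adjoint of [U'^T compl_proj U] is bounded by [compl_proj_perturb_sym]. *)
  have : mxnrm b <= d * mxnrm (compl_proj U *m Z).
    rewrite -(ler_pM2r bp) -expr2 sqr_mxnrm {1}/b mxip_mulmxl trmxK.
    rewrite -[in leLHS](compl_proj_idem UU) -mulmxA mxip_mulmxl compl_proj_tr.
    apply: le_trans (mxip_le _ _) _.
    apply: le_trans (ler_wpM2l (mxnrm_ge0 _) (compl_proj_perturb_sym _)) _.
    by rewrite mulrCA mulrA.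
  by rewrite mxnrm_le_sqr ?dn_ge0 // exprMn sqr_mxnrm.
rewrite mxnrm_le_sqr ?dn_ge0 // exprMn sqr_mxnrm.
rewrite !mxip_lin (mxipC c) mxip_orthoL // mxip_mulmxl Uc mxip0r.
by rewrite (compl_proj_pyth Z UU); lra.
Qed.

End Perturbation.
End TangentSpace.

(** * Change of tangent space, curvature of the manifold, stability of the rank *)

Section TangentPerturbation.
Variables (R : realType) (n r : nat) (X Y : 'M[R]_n) (U V U' V' : 'M[R]_(n, r)).
Variables (s s' : 'rV[R]_r) (sigma : R).
Hypothesis redX : is_reduced_svd X U s V.
Hypothesis redY : is_reduced_svd Y U' s' V'.
Hypothesis sigma_gt0 : 0 < sigma.
Hypothesis sigma_le : forall i, sigma <= s 0 i.

(** Exchanging the left and right projectors one at a time costs [d] each. *)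
Lemma tproj_perturb (Z : 'M[R]_n) : mxnrm (Y - X) / sigma < 1 ->
  mxnrm (tproj U' V' Z - tproj U V Z) <= 2 * (mxnrm (Y - X) / sigma) * mxnrm Z.
Proof.
move=> d1; have [[UU VV _ _ _] _] := redX; have [[UU' VV' _ _ _] _] := redY.
have -> : tproj U' V' Z - tproj U V Z =
    (U' *m U'^T - U *m U^T) *m (Z *m compl_proj V) +
    compl_proj U' *m Z *m (V' *m V'^T - V *m V^T).
  have -> : U' *m U'^T - U *m U^T = compl_proj U - compl_proj U'.
    by rewrite !compl_projE opprB [RHS]addrC addrA subrK.
  have -> : V' *m V'^T - V *m V^T = compl_proj V - compl_proj V'.
    by rewrite !compl_projE opprB [RHS]addrC addrA subrK.
  rewrite /tproj mulmxBl mulmxBr !mulmxA addrA subrK.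
  by rewrite opprB [LHS]addrC addrA subrK.
rewrite -mulrA mulr_natl mulr2n.
apply: le_trans (mxnrmD _ _) _; apply: lerD.
  apply: le_trans (proj_perturb redX redY sigma_gt0 sigma_le d1 _) _.
  by rewrite ler_wpM2l ?divr_ge0 ?mxnrm_ge0 ?(ltW sigma_gt0) // mxnrm_compl_projr.
rewrite -mxnrm_tr trmx_mul raddfB /= !trmx_mul !trmxK compl_proj_tr.
have := @proj_perturb R n r X^T Y^T V U V' U' s s' sigma (reduced_svd_tr redX)
  (reduced_svd_tr redY) sigma_gt0 sigma_le.
rewrite -raddfB /= mxnrm_tr => h; apply: le_trans (h d1 _ _) _.
rewrite ler_wpM2l ?divr_ge0 ?mxnrm_ge0 ?(ltW sigma_gt0) //.
by apply: le_trans (mxnrm_compl_projr _ UU') _; rewrite mxnrm_tr.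
Qed.

(** Second order: [Y] vanishes under either complement and [X = U U^T X], so one factor [d] comes
    from the complement of [U'] acting on [U] and the other factor is |Y - X|. *)
Lemma tproj_residual :
  mxnrm ((Y - X) - tproj U' V' (Y - X)) <= mxnrm (Y - X) / sigma * mxnrm (Y - X).
Proof.
have [[UU VV _ _ XE] _] := redX; have [[UU' VV' _ _ YE] _] := redY.
have YU : compl_proj U' *m Y = 0 by rewrite YE !mulmxA compl_projU // !mul0mx.
have YV : Y *m compl_proj V' = 0 by rewrite YE -mulmxA compl_projUT // mulmx0.
have XU : X = U *m (U^T *m X) by rewrite XE !mulmxA -(mulmxA U U^T) UU mulmx1.
rewrite /tproj subKr.
have -> : compl_proj U' *m (Y - X) *m compl_proj V' =
    compl_proj U' *m (U *m (U^T *m ((Y - X) *m compl_proj V'))).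
  rewrite mulmxBl YV sub0r mulmxBr YU sub0r !mulmxN mulNmx; congr (- _).
  by rewrite {1}XU !mulmxA.
apply: le_trans (compl_proj_perturb redX redY sigma_gt0 sigma_le _) _.
rewrite ler_wpM2l ?divr_ge0 ?mxnrm_ge0 ?(ltW sigma_gt0) //.
by apply: le_trans (mxnrm_orthoT _ UU) _; exact: mxnrm_compl_projr.
Qed.

(** [X] stretches the span of [V] by at least [sigma], so a closer [B] remains injective there. *)
Lemma rank_of_near (B : 'M[R]_n) : mxnrm (B - X) < sigma -> (r <= \rank B)%N.
Proof.
move=> BX; have [[UU VV s0 _ XE] _] := redX.
have : row_free (B *m V)^T.
  rewrite -kermx_eq0 -trmx_eq0; move: (kermx _) (mulmx_ker (B *m V)^T) => K KB.
  apply/negPn/negP => K0.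
  have BK : B *m (V *m K^T) = 0.
    by rewrite mulmxA -[LHS]trmxK trmx_mul trmxK KB trmx0.
  have Kp : 0 < mxnrm K^T by rewrite mxnrm_gt0.
  have h1 : sigma * mxnrm K^T <= mxnrm (X *m (V *m K^T)).
    rewrite XE !mulmxA -(mulmxA _ V^T) VV mulmx1 -mulmxA mxnrm_orthoL //.
    by rewrite -(mxnrm_tr (_ *m _)) trmx_mul trmxK tr_diag_mx mxnrm_tr;
       apply: mxnrm_mul_diag_ge => //; exact: ltW.
  have h2 : mxnrm (X *m (V *m K^T)) <= mxnrm (B - X) * mxnrm K^T.
    rewrite -mxnrmN -(add0r (- _)) -BK -mulmxBl.
    by apply: le_trans (mxnrm_mul _ _) _; rewrite mxnrm_orthoL.
  by have := le_trans h1 h2; rewrite ler_pM2r // leNgt BX.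
rewrite /row_free mxrank_tr => /eqP <-; exact: mxrankM_maxl.
Qed.

End TangentPerturbation.

(** * Hard thresholding as best approximation of rank r *)

Section HardThreshold.
Variable R : realType.

Lemma hard_threshold_rank n r (W Y : 'M[R]_n) :
  hard_threshold r W Y -> (\rank Y <= r)%N.
Proof.
move=> [U [s [V [_ ->]]]]; have [nr|rn] := leqP n r.
  exact: leq_trans (rank_leq_row _) nr.
rewrite (svd_narrow (ltnW rn)); last by move=> i ri; rewrite mxE ltnNge ri.
by rewrite -mulmxA (leq_trans (mxrankM_maxl _ _)) // rank_leq_col.
Qed.

Lemma sum_ord_lt n r : (r <= n)%N -> \sum_(j < n) (j < r)%:R = r%:R :> R.
Proof.
move=> rn; rewrite (bigID (fun j : 'I_n => j < r)%N) /= [X in _ + X]big1 ?addr0.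
  rewrite (big_ord_narrow rn) /= (eq_bigr (fun=> 1)) => [|i _].
    by rewrite sumr_const card_ord.
  by rewrite ltn_ord.
by move=> j /negbTE ->.
Qed.

Lemma mxip_mul_diag p k (A : 'M[R]_(p, k)) (d : 'rV[R]_k) :
  mxip (A *m diag_mx d) (A *m diag_mx d) = \sum_j (\sum_i A i j ^+ 2) * d 0 j ^+ 2.
Proof.
rewrite /mxip exchange_big; apply: eq_bigr => j _; rewrite mulr_suml.
by apply: eq_bigr => i _; rewrite mul_mx_diag !mxE -expr2 exprMn.
Qed.

Lemma mxip_diag k (d : 'rV[R]_k) :
  mxip (diag_mx d) (diag_mx d) = \sum_j d 0 j ^+ 2.
Proof.
rewrite -[diag_mx d]mul1mx mxip_mul_diag; apply: eq_bigr => j _.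
rewrite (bigD1 j) //= big1 => [|i ij]; first by rewrite mxE eqxx addr0 expr1n mul1r.
by rewrite mxE (negbTE ij) expr0n.
Qed.

(* With [q j] the squared length of the projection of the j-th left singular vector
   on the column space of [X], one has [0 <= q j <= 1] and [\sum_j q j = r]. *)
Lemma hard_threshold_best n r (X W Y : 'M[R]_n) (U V : 'M[R]_(n, r)) s :
  (0 < r)%N -> is_reduced_svd X U s V -> hard_threshold r W Y ->
  mxnrm (Y - W) <= mxnrm (X - W).
Proof.
move=> r0 red [U0 [t [V0 [[UU0 VV0 t0 tle WE] YE]]]].
have [[UU VV _ _ XE] _] := red.
have rn : (r <= n)%N by rewrite -(reduced_svd_rank red) rank_leq_row.
have r1n : (r.-1 < n)%N by rewrite prednK.
pose c := t 0 (Ordinal r1n) ^+ 2.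
pose q j := \sum_i (U^T *m U0) i j ^+ 2.
have q0 j : 0 <= q j by apply: sumr_ge0 => i _; exact: sqr_ge0.
have q1 j : q j <= 1.
  have := mxnrm_orthoT (col j U0) UU; rewrite mxnrm_le.
  have -> : mxip (col j U0) (col j U0) = 1.
    rewrite colE mxip_orthoL // -mxip_tr trmx_delta -sqr_mxnrm mxnrm_delta expr1n //.
  apply: le_trans; rewrite /mxip; apply: ler_sum => i _; rewrite big_ord1 -expr2.
  by rewrite colE mulmxA -colE [X in _ <= X ^+ 2]mxE.
have sq : \sum_j q j = r%:R.
  transitivity (mxip (U^T *m U0) (U^T *m U0)).
    by rewrite /mxip exchange_big; apply: eq_bigr => j _; apply: eq_bigr.
  rewrite mxip_mulmxr -mulmxA (mulmx1C UU0) mulmx1 mxipE trmxK.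
  by rewrite mxtrace_mulC UU mxtrace1.
have nYW : mxip (Y - W) (Y - W) = \sum_(j < n) (r <= j)%:R * t 0 j ^+ 2.
  rewrite YE WE -mulmxBl -mulmxBr -raddfB /= mxip_orthoR // mxip_orthoL // mxip_diag.
  apply: eq_bigr => j _; rewrite !mxE [(r <= j)%N]leqNgt; case: ifP => _ /=.
    by rewrite subrr expr0n /= ?mulr0n ?mul0r.
  by rewrite sub0r sqrrN mul1r.
(* The complement of [U] kills [X], so |X - W| is at least the norm of the part of [W] outside the
   column space of [X]. *)
have nXW : mxip (X - W) (X - W) >= \sum_(j < n) (1 - q j) * t 0 j ^+ 2.
  rewrite (compl_proj_pyth (X - W) UU) ler_wpDl ?mxip_ge0 //.
  have -> : compl_proj U *m (X - W) = - (compl_proj U *m W).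
    by rewrite mulmxBr XE !mulmxA compl_projU // !mul0mx sub0r.
  have := compl_proj_pyth W UU; rewrite mxipNl mxipNr opprK.
  rewrite {1 2}WE mxip_orthoR // mxip_orthoL // mxip_diag.
  have -> : mxip (U^T *m W) (U^T *m W) = \sum_j q j * t 0 j ^+ 2.
    by rewrite WE !mulmxA mxip_orthoR // mxip_mul_diag.
  under [X in X <= _]eq_bigr do rewrite mulrBl mul1r.
  by rewrite sumrB => ->; rewrite addrC addKr.
rewrite mxnrm_le nYW; apply: le_trans nXW.
rewrite -subr_ge0 -sumrB.
(* The weights [(j < r) - q j] sum to zero, are nonnegative where [t 0 j ^+ 2 >= c] and nonpositive
   where it is [<= c]; replacing every squared singular value by [c] can only lower the sum. *)
have sum0 : \sum_(j < n) c * ((j < r)%:R - q j) = 0.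
  by rewrite -mulr_sumr sumrB sq sum_ord_lt // subrr mulr0.
rewrite -[leLHS]sum0.
apply: ler_sum => j _; rewrite [(r <= j)%N]leqNgt; case: ltnP => jr /=.
  have : c <= t 0 j ^+ 2.
    by rewrite ler_sqr ?nnegrE //; apply: tle; rewrite /= -ltnS prednK.
  by have := q1 j; nra.
have : t 0 j ^+ 2 <= c.
  by rewrite ler_sqr ?nnegrE //; apply: tle; rewrite /= (leq_trans (leq_pred _)).
by have := q0 j; nra.
Qed.

End HardThreshold.

(** * The sampling operator as a nonnegative diagonal operator *)

Section Sampling.
Variables (R : realType) (n : nat).

(** The a priori bound [C] ensures that the [sup] in [op_norm] is a genuine least upper bound and
    not a default value. *)
Lemma mxnrm_le_op_norm (A : 'M[R]_n -> 'M[R]_n) C :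
  (forall a Z, A (a *: Z) = a *: A Z) -> (forall Z, mxnrm (A Z) <= C * mxnrm Z) ->
  forall Z, mxnrm (A Z) <= op_norm A * mxnrm Z.
Proof.
move=> AZ AC Z; have [->|Z0] := eqVneq Z 0.
  by have := AZ 0 0; rewrite !scale0r => ->; rewrite mxnrm0 mulr0.
have Zp : 0 < mxnrm Z by rewrite mxnrm_gt0.
have : mxnrm (A ((mxnrm Z)^-1 *: Z)) <= op_norm A.
  apply: ub_le_sup.
    exists `|C| => _ [W W1 <-]; apply: le_trans (AC W) _; apply: le_trans (ler_norm _) _.
    by rewrite normrM [X in _ * X]ger0_norm ?mxnrm_ge0 // ler_piMr.
  exists ((mxnrm Z)^-1 *: Z) => //=; rewrite -[frob_norm _]/(mxnrm _) mxnrmZ.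
  by rewrite ger0_norm ?invr_ge0 ?mxnrm_ge0 // mulVf ?gt_eqF.
rewrite AZ mxnrmZ ger0_norm ?invr_ge0 ?mxnrm_ge0 //.
by rewrite mulrC ler_pdivrMr.
Qed.

Variables (m : nat) (Omega : m.-tuple ('I_n * 'I_n)).
Local Notation Om := (@sampling_op R n m Omega).

Definition multiplicity i j : R := \sum_(k <- Omega) ((i == k.1) && (j == k.2))%:R.

Lemma sampling_opE Z i j : Om Z i j = multiplicity i j * Z i j.
Proof.
rewrite /sampling_op mxE /multiplicity summxE; congr (_ * _).
by apply: eq_bigr => k _; rewrite mxE.
Qed.

Lemma multiplicity_ge0 i j : 0 <= multiplicity i j.
Proof. exact: sumr_ge0. Qed.

Lemma multiplicity_le i j : multiplicity i j <= m%:R.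
Proof.
apply: (@le_trans _ _ (\sum_(k <- Omega) 1)).
  by apply: ler_sum => k _; rewrite lern1 leq_b1.
by rewrite big_const_seq count_predT iter_addr_0 size_tuple.
Qed.

Lemma sum_multiplicity : \sum_i \sum_j multiplicity i j = m%:R.
Proof.
have -> : m%:R = \sum_(k <- Omega) (1 : R).
  by rewrite big_const_seq count_predT iter_addr_0 size_tuple.
rewrite pair_big /= exchange_big; apply: eq_bigr => k _ /=.
rewrite (bigD1 k) //= !eqxx big1 ?addr0 // => -[i j] /=.
by rewrite -pair_eqE /= => /negbTE ->.
Qed.

Lemma sampling_linear a A B : Om (a *: A + B) = a *: Om A + Om B.
Proof. by apply/matrixP => i j; rewrite !mxE; ring. Qed.

Lemma sampling_sym A B : mxip (Om A) B = mxip A (Om B).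
Proof.
by apply: eq_bigr => i _; apply: eq_bigr => j _; rewrite !sampling_opE mulrCA mulrA.
Qed.

Lemma sampling_nonneg A : 0 <= mxip A (Om A).
Proof.
apply: sumr_ge0 => i _; apply: sumr_ge0 => j _; rewrite sampling_opE mulrCA -expr2.
by rewrite mulr_ge0 ?sqr_ge0 ?multiplicity_ge0.
Qed.

Lemma sampling_norm_le Z : mxnrm (Om Z) <= m%:R * mxnrm Z.
Proof.
rewrite mxnrm_le_sqr ?mulr_ge0 ?mxnrm_ge0 // exprMn sqr_mxnrm /mxip mulr_sumr.
apply: ler_sum => k _; rewrite mulr_sumr; apply: ler_sum => l _.
rewrite sampling_opE -!expr2 exprMn ler_wpM2r ?sqr_ge0 //.
by rewrite ler_sqr ?nnegrE ?multiplicity_ge0 // multiplicity_le.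
Qed.

Lemma multiplicity_le_op_norm i j : multiplicity i j <= op_norm Om.
Proof.
have homo a Z : Om (a *: Z) = a *: Om Z.
  by apply/matrixP => k l; rewrite !mxE; ring.
have nd : mxnrm (delta_mx i j : 'M[R]_n) = 1.
  rewrite /mxnrm /mxip (bigD1 i) //= (bigD1 j) //= !mxE !eqxx mulr1.
  rewrite big1 => [|l lj]; last by rewrite !mxE (negbTE lj) andbF mulr0.
  rewrite big1 ?addr0 ?sqrtr1 // => k ki; rewrite big1 // => l _.
  by rewrite !mxE (negbTE ki) mulr0.
have := mxnrm_le_op_norm homo sampling_norm_le (delta_mx i j); rewrite nd mulr1.
have -> : Om (delta_mx i j) = multiplicity i j *: delta_mx i j.
  apply/matrixP => k l; rewrite sampling_opE !mxE.
  by case: eqP => [->|_]; case: eqP => [->|_] //=; rewrite !mulr0.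
by rewrite mxnrmZ nd mulr1 ger0_norm ?multiplicity_ge0.
Qed.

(** Entrywise: a multiplicity is nonnegative and at most the norm, so its square is at most the norm
    times itself. *)
Lemma sampling_bound A : mxip (Om A) (Om A) <= op_norm Om * mxip A (Om A).
Proof.
rewrite /mxip mulr_sumr; apply: ler_sum => i _; rewrite mulr_sumr; apply: ler_sum => j _.
rewrite !sampling_opE [A i j * _]mulrCA -mulrA [A i j * _]mulrCA.
apply: ler_wpM2r; last exact: multiplicity_le_op_norm.
by rewrite -expr2 mulr_ge0 ?sqr_ge0 ?multiplicity_ge0.
Qed.

(** The density is the average multiplicity, and the norm bounds each multiplicity. *)
Lemma op_norm_sampling_ge_density : (0 < n)%N -> m%:R / n%:R ^+ 2 <= op_norm Om.
Proof.
move=> n0; rewrite ler_pdivrMr ?exprn_gt0 ?ltr0n // -sum_multiplicity.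
apply: (@le_trans _ _ (\sum_(i < n) \sum_(j < n) op_norm Om)).
  by apply: ler_sum => i _; apply: ler_sum => j _; exact: multiplicity_le_op_norm.
by rewrite !sumr_const !card_ord -mulrnA -[_ *+ (n * n)]mulr_natr natrM expr2.
Qed.

Lemma op_norm_sampling_ge1 : (0 < m)%N -> 1 <= op_norm Om.
Proof.
move=> m0; have [k kO] : exists k, k \in tval Omega.
  exists (tnth Omega (Ordinal m0)); exact: mem_tnth.
apply: le_trans (multiplicity_le_op_norm k.1 k.2).
rewrite /multiplicity (perm_big _ (perm_to_rem kO)) big_cons !eqxx /=.
by rewrite lerDl sumr_ge0.
Qed.

End Sampling.

(** * Transfer of the restricted isometry between nearby tangent spaces *)

Section RIPTransfer.
Variables (R : realType) (n : nat) (Om P Q : 'M[R]_n -> 'M[R]_n) (L p e d : R).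
Hypothesis Om_linear : forall a A B, Om (a *: A + B) = a *: Om A + Om B.
Hypothesis Om_sym : forall A B, mxip (Om A) B = mxip A (Om B).
Hypothesis Om_bound : forall A, mxip (Om A) (Om A) <= L * mxip A (Om A).
Hypothesis projP : orthogonal_projector P.
Hypothesis projQ : orthogonal_projector Q.
Hypothesis (p_gt0 : 0 < p) (L_ge1 : 1 <= L) (pL : p <= L) (e_gt0 : 0 < e) (d_ge0 : 0 <= d).
Hypothesis d_small : d * (L * (1 + e)) <= Num.sqrt p * e.
Hypothesis PQ : forall Z, mxnrm (P Z - Q Z) <= d * mxnrm Z.
Hypothesis ripQ : forall Z, mxnrm (Q Z - p^-1 *: Q (Om (Q Z))) <= e * mxnrm Z.

Lemma linear_op_facts (A : 'M[R]_n -> 'M[R]_n) :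
  (forall a B C, A (a *: B + C) = a *: A B + A C) ->
  [/\ forall B C, A (B + C) = A B + A C, forall B C, A (B - C) = A B - A C,
      forall B, A (- B) = - A B, A 0 = 0 & forall a B, A (a *: B) = a *: A B].
Proof.
move=> lin; have A0 : A 0 = 0.
  have := lin 1 0 0; rewrite scaler0 addr0 scale1r => /eqP.
  by rewrite -subr_eq subrr eq_sym => /eqP.
have AZ a B : A (a *: B) = a *: A B by have := lin a B 0; rewrite addr0 A0 addr0.
have AN B : A (- B) = - A B by rewrite -scaleN1r AZ scaleN1r.
have AD B C : A (B + C) = A B + A C by rewrite -{1}(scale1r B) lin scale1r.
by split => // B C; rewrite AD AN.
Qed.

Lemma projector_contract (T : 'M[R]_n -> 'M[R]_n) Z :
  orthogonal_projector T -> mxnrm (T Z) <= mxnrm Z.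
Proof.
move=> [_ sym idem]; have [T0|T0] := eqVneq (T Z) 0.
  by rewrite T0 mxnrm0 mxnrm_ge0.
have Tp : 0 < mxnrm (T Z) by rewrite mxnrm_gt0.
rewrite -(ler_pM2r Tp) -expr2 sqr_mxnrm sym idem; exact: mxip_le.
Qed.

Let a := Num.sqrt (L * (1 + e)) * Num.sqrt p.

(** [Om_bound] spends one factor [L]; restricted isometry bounds the remaining quadratic form by
    [p (1 + e)]. *)
Lemma sampling_projQ Z : mxnrm (Om (Q Z)) <= a * mxnrm Z.
Proof.
have [[[[L1 e0] p0] pL'] d0] := (L_ge1, e_gt0, p_gt0, pL, d_ge0).
have [Qlin Qsym Qid] := projQ.
have L0 : 0 <= L by lra.
have Le0 : 0 <= L * (1 + e) by apply: mulr_ge0; lra.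
rewrite mxnrm_le_sqr ?mulr_ge0 ?sqrtr_ge0 ?mxnrm_ge0 // /a.
rewrite !exprMn !sqr_sqrtr ?mxip_ge0 ?(ltW p_gt0) //.
apply: le_trans (Om_bound _) _.
rewrite Qsym -!mulrA ler_wpM2l //.
apply: le_trans (mxip_le _ _) _.
have : mxnrm (Q (Om (Q Z))) <= p * ((1 + e) * mxnrm Z).
  have -> : Q (Om (Q Z)) = p *: (Q Z - (Q Z - p^-1 *: Q (Om (Q Z)))).
    by rewrite subKr scalerA divff ?gt_eqF // scale1r.
  rewrite mxnrmZ gtr0_norm // ler_pM2l //.
  apply: le_trans (mxnrmB _ _) _.
  by rewrite mulrDl mul1r lerD // projector_contract.
move=> h; apply: le_trans (ler_wpM2l (mxnrm_ge0 Z) h) _; rewrite -?sqr_mxnrm; lra.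
Qed.

Lemma sampling_norm Z : mxnrm (Om Z) <= L * mxnrm Z.
Proof.
have [[[[L1 e0] p0] pL'] d0] := (L_ge1, e_gt0, p_gt0, pL, d_ge0).
have [OZ0|OZ0] := eqVneq (Om Z) 0.
  by rewrite OZ0 mxnrm0 mulr_ge0 ?mxnrm_ge0 //; lra.
have Op : 0 < mxnrm (Om Z) by rewrite mxnrm_gt0.
rewrite -(ler_pM2r Op) -expr2 sqr_mxnrm; apply: le_trans (Om_bound _) _.
by rewrite -mulrA ler_wpM2l ?mxip_le //; lra.
Qed.

Lemma sampling_projP Z : mxnrm (Om (P Z)) <= (a + d * L) * mxnrm Z.
Proof.
have [[[[L1 e0] p0] pL'] d0] := (L_ge1, e_gt0, p_gt0, pL, d_ge0).
have [OD _ _ _ _] := linear_op_facts Om_linear.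
rewrite -[P Z](subrK (Q Z)) OD; apply: le_trans (mxnrmD _ _) _.
rewrite mulrDl addrC lerD ?sampling_projQ //.
apply: le_trans (sampling_norm _) _; rewrite (mulrC d) -mulrA ler_wpM2l //; lra.
Qed.

(** The adjoint of [sampling_projP]. *)
Lemma projP_sampling Z : mxnrm (P (Om Z)) <= (a + d * L) * mxnrm Z.
Proof.
have [[[[L1 e0] p0] pL'] d0] := (L_ge1, e_gt0, p_gt0, pL, d_ge0).
have [Plin Psym Pid] := projP; set W := P (Om Z).
have [W0|W0] := eqVneq W 0.
  rewrite W0 mxnrm0 mulr_ge0 ?mxnrm_ge0 // addr_ge0 ?mulr_ge0 ?sqrtr_ge0 //; lra.
have Wp : 0 < mxnrm W by rewrite mxnrm_gt0.
rewrite -(ler_pM2r Wp) -expr2 sqr_mxnrm {1}/W Psym Om_sym.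
apply: le_trans (mxip_le _ _) _; apply: le_trans (ler_wpM2l (mxnrm_ge0 _) (sampling_projP _)) _.
by rewrite mulrCA mulrA.
Qed.

Lemma projQ_sampling Z : mxnrm (Q (Om Z)) <= a * mxnrm Z.
Proof.
have [[[[L1 e0] p0] pL'] d0] := (L_ge1, e_gt0, p_gt0, pL, d_ge0).
have [Qlin Qsym Qid] := projQ; set W := Q (Om Z).
have [W0|W0] := eqVneq W 0.
  by rewrite W0 mxnrm0 !mulr_ge0 ?mxnrm_ge0 // sqrtr_ge0.
have Wp : 0 < mxnrm W by rewrite mxnrm_gt0.
rewrite -(ler_pM2r Wp) -expr2 sqr_mxnrm {1}/W Qsym Om_sym.
apply: le_trans (mxip_le _ _) _; apply: le_trans (ler_wpM2l (mxnrm_ge0 _) (sampling_projQ _)) _.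
by rewrite mulrCA mulrA.
Qed.

Lemma d_le_e : d <= e.
Proof.
have [[[[L1 e0] p0] pL'] d0] := (L_ge1, e_gt0, p_gt0, pL, d_ge0).
have sp : Num.sqrt p <= L.
  rewrite -ler_sqr ?nnegrE ?sqrtr_ge0 ?sqr_sqrtr; nra.
have h : d * (L * (1 + e)) <= e * (L * (1 + e)).
  apply: le_trans d_small _; rewrite mulrC ler_wpM2l ?(ltW e_gt0) //; nra.
by move: h; rewrite ler_pM2r //; nra.
Qed.

Lemma sampling_tail_const : (a + d * L) * d <= p * (e * (1 + e)).
Proof.
have [[[[L1 e0] p0] pL'] d0] := (L_ge1, e_gt0, p_gt0, pL, d_ge0).
pose y := Num.sqrt (L * (1 + e)); pose sp := Num.sqrt p.
have y2 : y ^+ 2 = L * (1 + e) by rewrite sqr_sqrtr //; nra.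
have sp2 : sp ^+ 2 = p by rewrite sqr_sqrtr // ltW.
have sp0 : 0 <= sp by exact: sqrtr_ge0.
have y1 : 1 <= y.
  rewrite -ler_sqr ?nnegrE ?sqrtr_ge0 // expr1n y2; nra.
rewrite -[a]/(y * sp) -sp2.
have h : d * y ^+ 2 <= sp * e by rewrite y2.
have hdy : d * y <= sp * e by apply: le_trans h; rewrite ler_wpM2l //; nra.
have hd : d <= sp * e by apply: le_trans hdy; rewrite ler_peMr.
have hdL : d * L <= sp * e.
  by apply: le_trans d_small; rewrite ler_wpM2l // ler_peMr; lra.
have h1 : d * y * sp <= sp * e * sp by rewrite ler_wpM2r.
have h2 : d * L * d <= (sp * e) * (sp * e) by rewrite ler_pM // mulr_ge0 //; lra.
by apply: le_trans (_ : d * y * sp + d * L * d <= _); lra.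
Qed.

(* AM-GM: [2 y <= 1 + y^2] with [y^2 = L (1 + e)]. *)
Lemma rip_const : d + p^-1 * (d * (a + d * L) + a * d) <= 3 * e.
Proof.
have [[[[L1 e0] p0] pL'] d0] := (L_ge1, e_gt0, p_gt0, pL, d_ge0).
pose y := Num.sqrt (L * (1 + e)); pose sp := Num.sqrt p.
have y2 : y ^+ 2 = L * (1 + e) by rewrite sqr_sqrtr //; nra.
have sp2 : sp ^+ 2 = p by rewrite sqr_sqrtr // ltW.
have sp0 : 0 < sp by rewrite sqrtr_gt0.
have spL : sp <= L.
  by rewrite -ler_sqr ?nnegrE ?(ltW sp0) ?sp2; nra.
rewrite -[a]/(y * sp) -sp2.
(* In this scaling the smallness hypothesis becomes [x * y ^+ 2 <= 1]. *)
pose x := d / (sp * e).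
have dx : d = x * (sp * e) by rewrite /x divfK // mulf_neq0 ?gt_eqF.
have x0 : 0 <= x by rewrite /x divr_ge0 // ltW // mulr_gt0.
have hx : x * y ^+ 2 <= 1.
  have sep : 0 < sp * e by rewrite mulr_gt0.
  by rewrite -(ler_pM2r sep) mul1r mulrAC -dx y2.
have -> : d + (sp ^+ 2)^-1 * (d * (y * sp + d * L) + y * sp * d) =
    e * (x * sp + 2 * y * x + x ^+ 2 * e * L).
  by rewrite dx; field; rewrite gt_eqF.
rewrite [3 * e]mulrC ler_pM2l //.
pose u := x * L.
have hu : u * (1 + e) <= 1 by rewrite /u -mulrA -y2.
have u0 : 0 <= u by rewrite /u mulr_ge0 //; lra.
have eu0 := mulr_ge0 (ltW e0) u0.
have xu : x <= u by rewrite /u ler_peMr.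
have t1 : x * sp <= u by rewrite /u ler_wpM2l.
have t2 : 2 * y * x <= x + 1.
  have := mulr_ge0 x0 (sqr_ge0 (y - 1)); nra.
have t3 : x ^+ 2 * e * L <= e * u.
  have -> : x ^+ 2 * e * L = (e * u) * x by rewrite /u; ring.
  by rewrite ler_piMr ?(mulr_ge0 (ltW e0) u0) //; lra.
lra.
Qed.

(** Replacing [P] by [Q] in each place costs [3 e] in all by [rip_const]; the isometry for [Q] adds
    [e]. *)
Lemma rip_transfer Z : mxnrm (P Z - p^-1 *: P (Om (P Z))) <= 4 * e * mxnrm Z.
Proof.
have [OD OB _ _ _] := linear_op_facts Om_linear.
have [_ QB _ _ _] := linear_op_facts (let: And3 h _ _ := projQ in h).
have -> : P Z - p^-1 *: P (Om (P Z)) =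
  (P Z - Q Z) + (Q Z - p^-1 *: Q (Om (Q Z)))
   - p^-1 *: ((P (Om (P Z)) - Q (Om (P Z))) + Q (Om (P Z - Q Z))).
  rewrite OB QB; move: (P Z) (Q Z) (P (Om (P Z))) (Q (Om (P Z))) (Q (Om (Q Z))).
  by move=> x y A B C; rewrite !addrA !subrK scalerBr opprB addrA subrK.
apply: le_trans (mxnrmB _ _) _.
apply: le_trans (lerD (mxnrmD _ _) (le_refl _)) _.
have pi0 : 0 < p^-1 by rewrite invr_gt0.
rewrite mxnrmZ gtr0_norm //.
have h1 : mxnrm (P (Om (P Z)) - Q (Om (P Z)) + Q (Om (P Z - Q Z))) <=
    (d * (a + d * L) + a * d) * mxnrm Z.
  apply: le_trans (mxnrmD _ _) _; rewrite mulrDl -!mulrA; apply: lerD.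
    apply: le_trans (PQ _) _; rewrite ler_wpM2l // sampling_projP //.
  apply: le_trans (projQ_sampling _) _; rewrite -mulrA ler_wpM2l ?sqrtr_ge0 //.
  by rewrite ler_wpM2l ?sqrtr_ge0.
have h2 := rip_const; have h3 := mxnrm_ge0 Z.
have h4 := ler_wpM2l (ltW pi0) h1.
have h5 := ler_wpM2r h3 h2.
have h6 := PQ Z; have h7 := ripQ Z.
apply: le_trans (lerD (lerD h6 h7) h4) _; lra.
Qed.

End RIPTransfer.

(** * One step of the conjugate gradient iteration *)

Section RCGStep.
Variables (R : realType) (n : nat) (Om P : 'M[R]_n -> 'M[R]_n) (p e k1 k2 : R).
Hypothesis Om_linear : forall a A B, Om (a *: A + B) = a *: Om A + Om B.
Hypothesis Om_sym : forall A B, mxip (Om A) B = mxip A (Om B).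
Hypothesis projP : orthogonal_projector P.
Hypothesis (p_gt0 : 0 < p) (e_gt0 : 0 < e) (k1_ge0 : 0 <= k1) (k2_ge0 : 0 <= k2).
Hypothesis rip : forall Z, mxnrm (P Z - p^-1 *: P (Om (P Z))) <= 4 * e * mxnrm Z.
Let D := (1 - 4 * e) - k1 * (1 + 4 * e).
Hypothesis D_gt0 : 0 < D.

Lemma rip_ip A B : P A = A -> P B = B ->
  `|mxip A (Om B) - p * mxip A B| <= p * (4 * e * (mxnrm A * mxnrm B)).
Proof.
move=> PA PB; have [_ Psym _] := projP.
have -> : mxip A (Om B) - p * mxip A B = - p * mxip A (P B - p^-1 *: P (Om (P B))).
  by rewrite !mxip_lin -!Psym PA PB; field; rewrite gt_eqF.
rewrite normrM [`|- p|]normrN (gtr0_norm p_gt0) ler_pM2l //.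
apply: le_trans (normr_mxip_le _ _) _.
by apply: le_trans (ler_wpM2l (mxnrm_ge0 _) (rip _)) _; rewrite mulrCA.
Qed.

Lemma sampling_coercive A : P A = A ->
  p * ((1 - 4 * e) * mxip A A) <= mxip A (Om A).
Proof.
move=> PA; have := rip_ip PA PA; rewrite -expr2 sqr_mxnrm ler_distl => /andP[h _]; lra.
Qed.

Let e4 : 0 < 1 - 4 * e.
Proof.
have := D_gt0; rewrite /D => h; have := mulr_ge0 k1_ge0 (_ : 0 <= 1 + 4 * e).
by have := e_gt0; lra.
Qed.

Lemma k1_le1 : k1 <= 1.
Proof.
have h := D_gt0; rewrite /D in h; have h1 := e_gt0; have h2 := k1_ge0; have h3 := e4.
rewrite leNgt; apply/negP => k; nra.
Qed.

Definition beta_bound := (4 * k2 * e + k1 * k2) / (1 - 4 * e).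

Lemma beta_bound_ge0 : 0 <= beta_bound.
Proof.
have h1 := e_gt0; have h2 := k1_ge0; have h3 := k2_ge0.
by rewrite divr_ge0 ?(ltW e4) // addr_ge0 ?mulr_ge0 // ltW.
Qed.

Section Beta.
Variables (g q : 'M[R]_n) (b : R).
Hypothesis (Pg : P g = g) (Pq : P q = q).
Hypothesis bE : b = if (`|mxip g q| / (mxnrm g * mxnrm q) <= k1) &&
                       (mxnrm g <= k2 * mxnrm q)
                    then - (mxip g (Om q) / mxip q (Om q)) else 0.

(** The last three facts keep a factor [b] so that they also hold after a restart, when [b = 0] and
    the two restart inequalities may fail. *)
Lemma beta_facts :
  [/\ `|b| <= beta_bound, b * mxip (g + b *: q) (Om q) = 0,
      `|b| * mxnrm q * (1 - 4 * e) <= (4 * e + k1) * mxnrm g &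
      `|b| * `|mxip g q| <= `|b| * (k1 * (mxnrm g * mxnrm q))].
Proof.
have e0 := e_gt0; have k10 := k1_ge0; have k20 := k2_ge0; have e4' := e4; have p0 := p_gt0.
have g0 := mxnrm_ge0 g; have q0 := mxnrm_ge0 q.
have triv : b = 0 -> [/\ `|b| <= beta_bound, b * mxip (g + b *: q) (Om q) = 0,
      `|b| * mxnrm q * (1 - 4 * e) <= (4 * e + k1) * mxnrm g &
      `|b| * `|mxip g q| <= `|b| * (k1 * (mxnrm g * mxnrm q))].
  move=> ->; rewrite normr0 !mul0r; split => //; first exact: beta_bound_ge0.
  by rewrite mulr_ge0 //; lra.
move: bE; case: ifP => [/andP[c1 c2] bE'|_]; last exact: triv.
(* Division by zero returns 0, so the formula gives [b = 0] here. *)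
have [qz|qn] := eqVneq q 0.
  apply: triv; rewrite bE' qz.
  by rewrite mxip0l invr0 mulr0 oppr0.
have [gz|gn] := eqVneq g 0; first by apply: triv; rewrite bE' gz mxip0l mul0r oppr0.
have qp : 0 < mxnrm q by rewrite mxnrm_gt0.
have gp : 0 < mxnrm g by rewrite mxnrm_gt0.
have c1' : `|mxip g q| <= k1 * (mxnrm g * mxnrm q).
  by move: c1; rewrite ler_pdivrMr // mulr_gt0.
have qq : mxip q q = mxnrm q ^+ 2 by rewrite sqr_mxnrm.
have wq := sampling_coercive Pq.
have wq0 : 0 < mxip q (Om q).
  apply: lt_le_trans wq; rewrite mulr_gt0 // mulr_gt0 // qq exprn_gt0 //.
have num : `|mxip g (Om q)| <= p * ((4 * e + k1) * (mxnrm g * mxnrm q)).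
  have := rip_ip Pg Pq; have := ler_normD (mxip g (Om q) - p * mxip g q) (p * mxip g q).
  rewrite subrK normrM (gtr0_norm p_gt0) => h1 h2.
  have h3 := ler_wpM2l (ltW p0) c1'; lra.
have nb : `|b| * mxip q (Om q) = `|mxip g (Om q)|.
  by rewrite bE' normrN normrM normfV (gtr0_norm wq0) divfK // gt_eqF.
have b3 : `|b| * mxnrm q * (1 - 4 * e) <= (4 * e + k1) * mxnrm g.
  rewrite -(ler_pM2l p0) -(ler_pM2r qp).
  apply: le_trans (_ : `|b| * mxip q (Om q) <= _); last by rewrite nb; lra.
  by apply: le_trans (ler_wpM2l (normr_ge0 b) wq); rewrite qq; lra.
split => //.
- rewrite /beta_bound ler_pdivlMr // -(ler_pM2r qp) mulrAC; apply: le_trans b3 _.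
  have ek : 0 <= 4 * e + k1 by lra.
  by have h := ler_wpM2l ek c2; lra.
- rewrite mxipDl mxipZl; apply/eqP; rewrite mulf_eq0; apply/orP; right.
  by rewrite bE' mulNr divfK ?subrr // gt_eqF.
- by rewrite ler_wpM2l.
Qed.

End Beta.

Definition eta := 4 * e / D.

(** If [d = 0] the quotient is 0 by convention and not close to [p^-1]; the step is then zero for
    any coefficient, so the lemma only provides some [a] producing the same step. *)
Lemma alpha_facts g q b : P g = g -> P q = q ->
  b * mxip (g + b *: q) (Om q) = 0 ->
  `|b| * mxnrm q * (1 - 4 * e) <= (4 * e + k1) * mxnrm g ->
  `|b| * `|mxip g q| <= `|b| * (k1 * (mxnrm g * mxnrm q)) ->
  let d := g + b *: q in
  exists2 a, (mxip g d / mxip d (Om d)) *: d = a *: d & `|a * p - 1| <= eta.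
Proof.
move=> Pg Pq conj bq bgq d.
have e0 := e_gt0; have k10 := k1_ge0; have e4' := e4; have p0 := p_gt0; have D0 := D_gt0.
have k11 := k1_le1; have g0 := mxnrm_ge0 g; have q0 := mxnrm_ge0 q; have d0 := mxnrm_ge0 d.
have [Plin Psym Pid] := projP; have [PD _ _ _ PZ] := linear_op_facts Plin.
have Pd : P d = d by rewrite /d PD PZ Pg Pq.
have eta0 : 0 <= eta by rewrite /eta divr_ge0 ?(ltW D0) //; lra.
(* Origin of [D]: the part of <g, d> due to [q] is at most [k1 (4 e + k1) / (1 - 4 e)] times |g|^2,
   and [k1 ^+ 2 <= k1]. *)
have dg : D * mxnrm g <= (1 - 4 * e) * mxnrm d.
  have [gz|gn] := eqVneq g 0.
    by rewrite gz mxnrm0 mulr0 mulr_ge0 // ltW.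
  have gp : 0 < mxnrm g by rewrite mxnrm_gt0.
  rewrite -(ler_pM2l gp).
  have h1 : mxip g d <= mxnrm g * mxnrm d := mxip_le g d.
  have h2 : mxip g d = mxnrm g ^+ 2 + b * mxip g q by rewrite sqr_mxnrm /d !mxip_lin.
  have h3 : - (b * mxip g q) <= `|b| * `|mxip g q|.
    by rewrite -normrM -normrN ler_norm.
  have h4 := ler_wpM2l (ltW e4') (le_trans h3 bgq).
  have h5 := ler_wpM2l (mulr_ge0 k10 g0) bq.
  have h6 := ler_wpM2l (ltW e4') h1; rewrite h2 in h6.
  have h7 : k1 * k1 <= k1 by rewrite ler_piMl.
  have h8 := ler_wpM2r (sqr_ge0 (mxnrm g)) h7.
  have DE : mxnrm g * (D * mxnrm g) = ((1 - 4 * e) - k1 * (1 + 4 * e)) * mxnrm g ^+ 2.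
    by rewrite /D; ring.
  rewrite DE; lra.
have [dz|dn] := eqVneq d 0.
  exists p^-1; first by rewrite dz !scaler0.
  by rewrite mulVf ?gt_eqF // subrr normr0.
have dp : 0 < mxnrm d by rewrite mxnrm_gt0.
have w := sampling_coercive Pd; rewrite -sqr_mxnrm in w.
have w0 : 0 < mxip d (Om d).
  by apply: lt_le_trans w; rewrite mulr_gt0 // mulr_gt0 // exprn_gt0.
exists (mxip g d / mxip d (Om d)) => //.
(* Conjugacy: now numerator and denominator of the step size differ only by the isometry defect of
   the pair [g], [d]. *)
have wg : mxip d (Om d) = mxip g (Om d).
  have bqd : b * mxip q (Om d) = 0 by rewrite -Om_sym mxipC.
  by rewrite {1}/d mxipDl mxipZl bqd addr0.
have -> : mxip g d / mxip d (Om d) * p - 1 =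
    - (mxip g (Om d) - p * mxip g d) / mxip d (Om d).
  by rewrite -wg; field; rewrite gt_eqF.
rewrite normrM normrN normfV (gtr0_norm w0) ler_pdivrMr // /eta mulrAC ler_pdivlMr //.
apply: le_trans (ler_wpM2r (ltW D0) (rip_ip Pg Pd)) _.
have h := ler_wpM2l (mulr_ge0 (mulr_ge0 (ltW p0) (ltW e0)) d0) dg.
have h' := ler_wpM2l (ltW e0) w.
lra.
Qed.

Lemma eta_ge : 4 * e <= eta.
Proof.
have e0 := e_gt0; have k10 := k1_ge0; have D0 := D_gt0.
rewrite /eta ler_pdivlMr // ler_piMr //; first by lra.
have := mulr_ge0 k10 (_ : 0 <= 1 + 4 * e); rewrite /D => h.
by have := h _; lra.
Qed.

(** The constant A of the overview: twice the sum of the tail [e / 2], the isometry defect [4 e],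
    the step size error [eta (1 + 4 e)] and the sampled tail [(1 + eta) (e / 2) (1 + e)], simplified
    by [e (1 + eta) <= eta]. *)
Definition gain := 10 * e + 2 * eta * (1 + 5 * e).
Definition grad_const := 1 + 4 * e + e / 2 * (1 + e).

Lemma grad_const_ge0 : 0 <= grad_const.
Proof.
have e0 := e_gt0; rewrite /grad_const addr_ge0 ?mulr_ge0 //; lra.
Qed.

Lemma rip_upper Z : mxnrm (P (Om (P Z))) <= p * ((1 + 4 * e) * mxnrm Z).
Proof.
have -> : P (Om (P Z)) = p *: (P Z - (P Z - p^-1 *: P (Om (P Z)))).
  by rewrite subKr scalerA divff ?gt_eqF // scale1r.
rewrite mxnrmZ gtr0_norm // ler_pM2l //.
apply: le_trans (mxnrmB _ _) _.
by rewrite mulrDl mul1r lerD // projector_contract.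
Qed.

Section Step.
Variables (E Pprev : 'M[R]_n) (b : R).
Hypothesis tail : mxnrm (E - P E) <= e / 2 * mxnrm E.
Hypothesis sampled_tail : mxnrm (P (Om (E - P E))) <= p * (e / 2 * (1 + e)) * mxnrm E.
Let g := P (Om (- E)).
Let q := P Pprev.
(** The first alternative covers the initial step, where [beta] is 0 by decree. *)
Hypothesis bE : b = 0 \/ b = if (`|mxip g q| / (mxnrm g * mxnrm q) <= k1) &&
                       (mxnrm g <= k2 * mxnrm q)
                    then - (mxip g (Om q) / mxip q (Om q)) else 0.
Let d := g + b *: q.

Let split_grad : g = - (P (Om (P E)) + P (Om (E - P E))).
Proof.
have [Plin _ _] := projP.
have [PD PB PN _ _] := linear_op_facts Plin.
have [OD OB ON _ _] := linear_op_facts Om_linear.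
by rewrite /g ON PN -PD -OD [P E + _]addrC subrK.
Qed.

Let b_le : `|b| <= beta_bound.
Proof.
have [_ _ Pid] := projP.
case: bE => [->|/(beta_facts (Pid _) (Pid _)) []//].
by rewrite normr0 beta_bound_ge0.
Qed.

Lemma grad_bound : mxnrm g <= p * (grad_const * mxnrm E).
Proof.
rewrite split_grad mxnrmN; apply: le_trans (mxnrmD _ _) _.
apply: le_trans (lerD (rip_upper _) sampled_tail) _.
by rewrite /grad_const; lra.
Qed.

Let q_le : mxnrm q <= mxnrm Pprev.
Proof. exact: projector_contract. Qed.

Lemma direction_bound :
  mxnrm d <= p * (grad_const * mxnrm E) + beta_bound * mxnrm Pprev.
Proof.
apply: le_trans (mxnrmD _ _) _; rewrite lerD ?grad_bound // mxnrmZ.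
by rewrite ler_pM ?normr_ge0 ?mxnrm_ge0.
Qed.

Lemma step_bound :
  2 * mxnrm (E + (mxip g d / mxip d (Om d)) *: d) <=
    gain * mxnrm E + 2 * (1 + eta) * beta_bound * (p^-1 * mxnrm Pprev).
Proof.
have [Plin _ Pid] := projP.
have e0 := e_gt0; have p0 := p_gt0; have bb0 := beta_bound_ge0; have e4' := e4.
have etae := eta_ge; have q_le' := q_le; have E0 := mxnrm_ge0 E.
have [a -> aeta] : exists2 a, (mxip g d / mxip d (Om d)) *: d = a *: d & `|a * p - 1| <= eta.
  case: bE => [bz|bE1].
    apply: (@alpha_facts g q b) => //; rewrite ?bz ?normr0 ?mul0r //; try exact: Pid.
    have := k1_ge0 => k10; apply: mulr_ge0; [lra|exact: mxnrm_ge0].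
  have [_ f1 f2 f3] := beta_facts (Pid _) (Pid _) bE1.
  by apply: (@alpha_facts g q b) => //; exact: Pid.
pose tl := E - P E.
have tail' : mxnrm tl <= e / 2 * mxnrm E := tail.
have sampled_tail' : mxnrm (P (Om tl)) <= p * (e / 2 * (1 + e)) * mxnrm E := sampled_tail.
have split_grad' : g = - (P (Om (P E)) + P (Om tl)) := split_grad.
(* With the ideal step size [p^-1], the tangent part of [E] leaves only the isometry defect; the
   other terms are the normal part, the step size error, the sampled normal part and the
   momentum. *)
have -> : E + a *: d = tl + (P E - p^-1 *: P (Om (P E)))
    + (p^-1 - a) *: P (Om (P E)) - a *: P (Om tl) + (a * b) *: q.
  rewrite /d split_grad' scalerDr scalerN scalerDr scalerA scalerBl.
  move: (P (Om tl)) => C; rewrite /tl; move: (P E) (P (Om (P E))) => A B.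
  by rewrite !addrA !subrK opprD !addrA.
have pi0 : 0 < p^-1 by rewrite invr_gt0.
have na : `|a| <= p^-1 * (1 + eta).
  rewrite ler_pdivlMl //; have := ler_normD (a * p - 1) 1.
  rewrite subrK normrM normr1 (gtr0_norm p_gt0); lra.
have n1 : mxnrm ((p^-1 - a) *: P (Om (P E))) <= eta * ((1 + 4 * e) * mxnrm E).
  have -> : p^-1 - a = - p^-1 * (a * p - 1) by field; rewrite gt_eqF.
  rewrite mxnrmZ normrM normrN (gtr0_norm pi0) mulrAC.
  rewrite [leRHS]mulrC ler_pM ?mulr_ge0 ?mxnrm_ge0 ?normr_ge0 ?(ltW pi0) //.
  by rewrite ler_pdivrMl // rip_upper.
have n2 : mxnrm (a *: P (Om tl)) <= (1 + eta) * (e / 2 * (1 + e) * mxnrm E).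
  rewrite mxnrmZ; apply: le_trans (ler_pM (normr_ge0 _) (mxnrm_ge0 _) na sampled_tail') _.
  rewrite le_eqVlt; apply/orP; left; apply/eqP; field; rewrite gt_eqF //.
have n3 : mxnrm ((a * b) *: q) <= (1 + eta) * beta_bound * (p^-1 * mxnrm Pprev).
  rewrite mxnrmZ normrM.
  apply: le_trans (ler_pM (mulr_ge0 (normr_ge0 _) (normr_ge0 _)) (mxnrm_ge0 _)
    (ler_pM (normr_ge0 _) (normr_ge0 _) na b_le) q_le) _; lra.
have n4 := rip E.
have h1 := mxnrmD (tl + (P E - p^-1 *: P (Om (P E)))
    + (p^-1 - a) *: P (Om (P E)) - a *: P (Om tl)) ((a * b) *: q).
have h2 := mxnrmB (tl + (P E - p^-1 *: P (Om (P E)))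
    + (p^-1 - a) *: P (Om (P E))) (a *: P (Om tl)).
have h3 := mxnrmD (tl + (P E - p^-1 *: P (Om (P E)))) ((p^-1 - a) *: P (Om (P E))).
have h4 := mxnrmD tl (P E - p^-1 *: P (Om (P E))).
have c : e * (1 + eta) <= eta by nra.
have c' := ler_wpM2r E0 (ler_wpM2l (ltW e0) c).
rewrite /gain; lra.
Qed.

End Step.
End RCGStep.

(** * Algebra of the rate *)

Section RateFacts.
Variables (R : realType) (k1 k2 e : R).
Hypothesis (e_gt0 : 0 < e) (k1_ge0 : 0 <= k1) (k2_ge0 : 0 <= k2).
Hypothesis D_gt0 : 0 < (1 - 4 * e) - k1 * (1 + 4 * e).

Let e4 : 0 < 1 - 4 * e.
Proof.
have h := D_gt0; have h1 := e_gt0.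
have h2 : 0 <= 1 + 4 * e by lra.
by have h3 := mulr_ge0 k1_ge0 h2; lra.
Qed.

Lemma tau1E : tau1 k1 k2 e = gain e k1 + beta_bound e k1 k2.
Proof.
by rewrite /tau1 /gain /eta /beta_bound; congr (_ + _); field; rewrite gt_eqF.
Qed.

Lemma tau2E : tau2 k1 k2 e = 2 * beta_bound e k1 k2.
Proof. by rewrite /tau2 /beta_bound; field; rewrite gt_eqF. Qed.

Let bb0 : 0 <= beta_bound e k1 k2.
Proof. exact: beta_bound_ge0. Qed.

Let eta0 : 4 * e <= eta e k1.
Proof. exact: eta_ge. Qed.

Lemma gain_ge0 : 0 <= gain e k1.
Proof.
have h1 := e_gt0; have h2 := eta0; have h3 : 0 <= eta e k1 by lra.
have h4 : 0 <= 1 + 5 * e by lra.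
by have := mulr_ge0 h3 h4; rewrite /gain; lra.
Qed.

(** The two sides differ by exactly [(1 + eta) * e * (1 - e)]. *)
Lemma grad_gain : 2 * (1 + eta e k1) * grad_const e <= gain e k1 + 2.
Proof.
have h1 := e_gt0; have h2 := eta0; have h3 := e4.
have h4 : 0 <= 1 + eta e k1 by lra.
have h5 : 0 <= e * (1 - e) by apply: mulr_ge0; lra.
have h6 := mulr_ge0 h4 h5.
rewrite /gain /grad_const; lra.
Qed.

Lemma nu_cg_facts : tau1 k1 k2 e + tau2 k1 k2 e < 1 ->
  [/\ nu_cg k1 k2 e < 1, 0 <= nu_cg k1 k2 e, gain e k1 <= nu_cg k1 k2 e &
   nu_cg k1 k2 e ^+ 2 = (gain e k1 + beta_bound e k1 k2) * nu_cg k1 k2 e + 2 * beta_bound e k1 k2].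
Proof.
rewrite /nu_cg tau1E tau2E; set t := gain e k1 + _; set u := 2 * _ => tu.
have g0 := gain_ge0; have b0 := bb0.
have u0 : 0 <= u by rewrite mulr_ge0.
have t0 : 0 <= t by rewrite addr_ge0.
have disc : 0 <= t ^+ 2 + 4 * u by rewrite addr_ge0 ?sqr_ge0 // mulr_ge0.
set w := Num.sqrt _.
have w2 : w ^+ 2 = t ^+ 2 + 4 * u by rewrite sqr_sqrtr.
have w0 : 0 <= w by exact: sqrtr_ge0.
have wt : t <= w by rewrite -ler_sqr ?nnegrE // w2; lra.
(* After squaring, this is [t + u < 1]. *)
have w1 : w < 2 - t.
  rewrite -ltr_sqr ?nnegrE // ?w2; [|lra]; rewrite expr2; lra.
have gt : gain e k1 <= t by rewrite lerDl.
split; [lra|lra|lra|].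
have -> : ((t + w) / 2) ^+ 2 = (t ^+ 2 + 2 * t * w + w ^+ 2) / 4 by field.
by rewrite w2; field.
Qed.

End RateFacts.

(** * Induction along the iterates *)

Section Convergence.
Variables (R : realType) (n m r : nat) (Omega : m.-tuple ('I_n * 'I_n)).
Variables (X X0 : 'M[R]_n) (U V : 'M[R]_(n, r)) (s : 'rV[R]_r) (L p e k1 k2 sigma : R).
Local Notation Om := (@sampling_op R n m Omega).
Hypothesis r_gt0 : (0 < r)%N.
Hypothesis redX : is_reduced_svd X U s V.
Hypothesis sigma_gt0 : 0 < sigma.
Hypothesis sigma_le : forall i, sigma <= s 0 i.
Hypothesis Om_bound : forall A, mxip (Om A) (Om A) <= L * mxip A (Om A).
Hypothesis (p_gt0 : 0 < p) (L_ge1 : 1 <= L) (pL : p <= L) (e_gt0 : 0 < e).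
Hypothesis (k1_ge0 : 0 <= k1) (k2_ge0 : 0 <= k2).
Hypothesis D_gt0 : 0 < (1 - 4 * e) - k1 * (1 + 4 * e).
Hypothesis tau_lt1 : tau1 k1 k2 e + tau2 k1 k2 e < 1.
Hypothesis ripX : forall Z,
  mxnrm (tproj U V Z - p^-1 *: tproj U V (Om (tproj U V Z))) <= e * mxnrm Z.
Hypothesis X0_near :
  2 * (mxnrm (X0 - X) / sigma) * (L * (1 + e)) <= Num.sqrt p * e.

Lemma near_facts Y : \rank Y = r -> mxnrm (Y - X) <= mxnrm (X0 - X) ->
  exists (U' V' : 'M[R]_(n, r)) s', let P := tproj U' V' in
  [/\ is_reduced_svd Y U' s' V',
      forall Z, mxnrm (P Z - p^-1 *: P (Om (P Z))) <= 4 * e * mxnrm Z,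
      mxnrm ((Y - X) - P (Y - X)) <= e / 2 * mxnrm (Y - X) &
      mxnrm (P (Om ((Y - X) - P (Y - X)))) <= p * (e / 2 * (1 + e)) * mxnrm (Y - X)].
Proof.
move=> Yr YX0; have [W [t [W' svdY]]] := exists_svd Y.
have [] := reduced_svd_of_svd svdY; rewrite Yr => kn redY.
set U' := colsub _ W in redY; set V' := colsub _ W' in redY; set s' := colsub _ t in redY.
exists U', V', s'; move=> P.
have [[UU VV _ _ _] _] := redX; have [[UU' VV' _ _ _] _] := redY.
have projP := tproj_orthogonal_projector UU' VV'.
have projQ := tproj_orthogonal_projector UU VV.
have e0 := e_gt0; have L1 := L_ge1; have p0 := p_gt0; have Dp := D_gt0.
pose dl := mxnrm (Y - X) / sigma.
have dl0 : 0 <= dl by rewrite divr_ge0 ?mxnrm_ge0 // ltW.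
have d20 : 0 <= 2 * dl by rewrite mulr_ge0.
have small : 2 * dl * (L * (1 + e)) <= Num.sqrt p * e.
  apply: le_trans X0_near; rewrite ler_wpM2r //; first by rewrite mulr_ge0 //; lra.
  by rewrite ler_wpM2l // ler_wpM2r // invr_ge0 ltW.
(* The tangent projections are [2 * dl] apart while the normal part is only [dl] times the error;
   hence the constants [e / 2] for the tails. *)
have de : 2 * dl <= e := d_le_e p_gt0 L_ge1 pL e_gt0 d20 small.
have k1e : 0 <= k1 * (1 + 4 * e) by rewrite mulr_ge0 //; lra.
have dl1 : dl < 1 by lra.
have PQ Z : mxnrm (P Z - tproj U V Z) <= 2 * dl * mxnrm Z.
  exact: (tproj_perturb redX redY sigma_gt0 sigma_le Z dl1).
have res : mxnrm ((Y - X) - P (Y - X)) <= dl * mxnrm (Y - X).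
  exact: (tproj_residual redX redY sigma_gt0 sigma_le).
split => //.
- move=> Z; apply: (@rip_transfer R n Om P (tproj U V) L p e (2 * dl)) => //.
  + exact: sampling_linear.
  + exact: sampling_sym.
- by apply: le_trans res _; rewrite ler_wpM2r ?mxnrm_ge0 //; lra.
- have h : mxnrm (P (Om ((Y - X) - P (Y - X)))) <=
      (Num.sqrt (L * (1 + e)) * Num.sqrt p + 2 * dl * L) * mxnrm ((Y - X) - P (Y - X)).
    apply: (@projP_sampling R n Om P (tproj U V) L p e (2 * dl)) => //.
    + exact: sampling_linear.
    + exact: sampling_sym.
  have c := sampling_tail_const p_gt0 L_ge1 pL e_gt0 d20 small.
  apply: le_trans h _.
  set a := Num.sqrt _ * _ + _ in c *.
  have a0 : 0 <= a.
    by apply: addr_ge0; apply: mulr_ge0; rewrite ?sqrtr_ge0 //; lra.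
  apply: le_trans (ler_wpM2l a0 res) _.
  rewrite [leLHS]mulrA; apply: ler_wpM2r; [exact: mxnrm_ge0 | lra].
Qed.

Lemma rcg_error_bound (Xs Ps : nat -> 'M[R]_n) (alpha beta : nat -> R) :
  \rank X0 = r -> Xs 0%N = X0 ->
  restarted_rcg r Omega k1 k2 X Xs Ps alpha beta ->
  forall l, mxnrm (Xs l - X) <= nu_cg k1 k2 e ^+ l * mxnrm (X0 - X).
Proof.
move=> X0r Xs0 rcg.
have [nu1 nu0 gnu nu2] := nu_cg_facts e_gt0 k1_ge0 k2_ge0 D_gt0 tau_lt1.
have gg := grad_gain e_gt0 k1_ge0 D_gt0.
have e0 := e_gt0; have p0 := p_gt0.
have bb0 : 0 <= beta_bound e k1 k2 by exact: beta_bound_ge0.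
have etae : 4 * e <= eta e k1 by exact: eta_ge.
have pi0 : 0 < p^-1 by rewrite invr_gt0.
set nu := nu_cg k1 k2 e in nu1 nu0 gnu nu2 *; set bb := beta_bound e k1 k2 in bb0 nu2.
set et := eta e k1 in etae gg; set ga := gain e k1 in gnu nu2 gg.
set gc := grad_const e in gg; set er := mxnrm (X0 - X).
have er0 : 0 <= er by exact: mxnrm_ge0.
pose prev l := if l is l'.+1 then Ps l' else 0.
(* The third clause records the momentum through the whole right-hand side of the next error bound;
   this is what closes the two-term recurrence without a separate bound on [Ps]. *)
suff H l : [/\ \rank (Xs l) = r, mxnrm (Xs l - X) <= nu ^+ l * er &
    ga * (nu ^+ l * er) + 2 * (1 + et) * bb * (p^-1 * mxnrm (prev l)) <= nu ^+ l.+1 * er].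
  by move=> l; have [] := H l.
elim: l => [|l [Xlr Xle Pl]].
  split; rewrite ?Xs0 //; first by rewrite expr0 mul1r.
  rewrite /prev mxnrm0 !mulr0 addr0 expr0 mul1r expr1; exact: ler_wpM2r.
have nul0 : 0 <= nu ^+ l by exact: exprn_ge0.
have nule : nu ^+ l <= 1 by rewrite exprn_ile1 // ltW.
have Xle0 : mxnrm (Xs l - X) <= er by apply: le_trans Xle _; exact: ler_piMl.
have [U' [V' [s' [redY rip4 tail stail]]]] := near_facts Xlr Xle0.
have [[UU' VV' _ _ _] _] := redY.
have projP := tproj_orthogonal_projector UU' VV'.
have [Plin _ Pid] := projP; have [PD _ _ _ PZ] := linear_op_facts Plin.
set P := tproj U' V' in rip4 tail stail projP Plin Pid PD PZ.
set E := Xs l - X in Xle Xle0 tail stail.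
have PT Z : orth_proj (tangent_space r (Xs l)) Z = P Z := orth_proj_tangentE Z redY.
have gradE : rcg_grad Omega X (Xs l) = Om (- E) by rewrite /rcg_grad /E opprB.
have [betaE PsE alphaE hard] := rcg l.
rewrite -/(prev l) in betaE PsE.
have rb : rcg_beta r Omega k1 k2 X (Xs l) (prev l) =
    if (`|mxip (P (Om (- E))) (P (prev l))| /
      (mxnrm (P (Om (- E))) * mxnrm (P (prev l))) <= k1) &&
      (mxnrm (P (Om (- E))) <= k2 * mxnrm (P (prev l)))
    then - (mxip (P (Om (- E))) (Om (P (prev l))) / mxip (P (prev l)) (Om (P (prev l))))
    else 0.
  by rewrite /rcg_beta /rcg_no_restart gradE !PT.
have bE : beta l = 0 \/ beta l = rcg_beta r Omega k1 k2 X (Xs l) (prev l).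
  by rewrite betaE; case: (l) => [|l']; [left | right].
rewrite rb in bE.
have dE : Ps l = P (Om (- E)) + beta l *: P (prev l) by rewrite PsE gradE !PT.
have Pd : P (Ps l) = Ps l by rewrite dE PD PZ !Pid.
have aE : alpha l = mxip (P (Om (- E))) (Ps l) / mxip (Ps l) (Om (Ps l)).
  by rewrite alphaE /rcg_alpha gradE !PT Pd.
have st := step_bound (@sampling_linear R n m Omega) (@sampling_sym R n m Omega)
  projP p_gt0 e_gt0 k1_ge0 k2_ge0 rip4 D_gt0 tail stail bE.
rewrite -dE -aE -/ga -/et -/bb in st.
have db := direction_bound (@sampling_linear R n m Omega) projP p_gt0 e_gt0 k1_ge0 k2_ge0
  rip4 D_gt0 stail bE.
rewrite -dE -/gc -/bb in db.
have g0 : 0 <= ga by exact: gain_ge0.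
have WX : E + alpha l *: Ps l = (Xs l + alpha l *: Ps l) - X by rewrite /E addrAC.
have err : mxnrm (Xs l.+1 - X) <= nu ^+ l.+1 * er.
  apply: le_trans Pl; apply: le_trans (le_trans st _); last first.
    by rewrite lerD2r ler_wpM2l.
  rewrite WX; set W := Xs l + _; rewrite -/W in hard.
  have -> : Xs l.+1 - X = (Xs l.+1 - W) + (W - X) by rewrite addrA subrK.
  apply: le_trans (mxnrmD _ _) _.
  have := hard_threshold_best r_gt0 redX hard; rewrite (mxnrm_distC X W); lra.
have d0 : 0 <= 2 * (er / sigma) by rewrite mulr_ge0 // divr_ge0 // ltW.
(* From [2 * (er / sigma) <= e] and [4 * e < 1]. *)
have er_sigma : er < sigma.
  have := d_le_e p_gt0 L_ge1 pL e_gt0 d0 X0_near.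
  have k1e : 0 <= k1 * (1 + 4 * e) by rewrite mulr_ge0 //; lra.
  have Dp := D_gt0; move=> h.
  by rewrite -[ltRHS]mul1r -ltr_pdivrMr //; lra.
have erl : mxnrm (Xs l.+1 - X) < sigma.
  apply: le_lt_trans er_sigma; apply: le_trans err _; apply: ler_piMl => //.
  by rewrite exprn_ile1 // ltW.
split => //.
  apply/eqP; rewrite eqn_leq (hard_threshold_rank hard).
  exact: (rank_of_near redX sigma_gt0 sigma_le erl).
rewrite -[prev l.+1]/(Ps l).
pose N := nu ^+ l * er; have N0 : 0 <= N by rewrite mulr_ge0.
pose q := p^-1 * mxnrm (prev l).
have -> : nu ^+ l.+2 * er = nu ^+ 2 * N by rewrite /N !exprS expr0; ring.
have -> : nu ^+ l.+1 * er = nu * N by rewrite /N exprS; ring.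
have Pl' : ga * N + 2 * (1 + et) * bb * q <= nu * N.
  by apply: le_trans Pl _; rewrite exprS -mulrA.
have dN : p^-1 * mxnrm (Ps l) <= gc * N + bb * q.
  apply: le_trans (ler_wpM2l (ltW pi0) db) _.
  have -> : p^-1 * (p * (gc * mxnrm E) + bb * mxnrm (prev l)) = gc * mxnrm E + bb * q.
    by rewrite /q; field; rewrite gt_eqF.
  rewrite lerD2r ler_wpM2l //; exact: grad_const_ge0.
have eb0 : 0 <= 2 * (1 + et) * bb by apply: mulr_ge0 => //; lra.
(* Inserting [dN], then [grad_gain] for the part in [N] and the old invariant for the part in [q],
   the terms [bb * ga * N] cancel and the equation of [nu] remains. *)
have h1 := ler_wpM2l bb0 Pl'.
have h2 := ler_wpM2r (mulr_ge0 bb0 N0) gg.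
have h3 := ler_wpM2l eb0 dN.
rewrite nu2; lra.
Qed.

End Convergence.

(** * Behaviour of the rates as eps0 tends to zero *)

Section Limits.
Variable R : realType.

Lemma cvg_tau_sum (kappa1 kappa2 : R) : kappa1 != 1 ->
  tau1 kappa1 kappa2 e + tau2 kappa1 kappa2 e @[e --> (0 : R)] --> 3 * kappa1 * kappa2.
Proof.
move=> k1.
have -> : 3 * kappa1 * kappa2 = tau1 kappa1 kappa2 0 + tau2 kappa1 kappa2 0.
  by rewrite /tau1 /tau2; field; rewrite subr_eq0 eq_sym.
have aff (a b : R) : (fun e : R => a + b * e) @ (0 : R) --> a + b * 0.
  by apply: cvgD; [exact: cvg_cst | apply: cvgM; [exact: cvg_cst | exact: cvg_id]].
(* The same function with affine building blocks, so that continuity follows from [aff];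
   [kappa1 != 1] keeps the first denominator nonzero at 0. *)
pose f (e : R) := ((0 + (18 - 10 * kappa1) * e) - (0 + 40 * kappa1 * e) * e) /
    ((1 - kappa1) + (- (4 + 4 * kappa1)) * e) + 
    (3 * kappa1 * kappa2 + 12 * kappa2 * e) / (1 + (- 4) * e).
have fE : (fun e : R => tau1 kappa1 kappa2 e + tau2 kappa1 kappa2 e) = f.
  apply/funext => e; rewrite /f /tau1 /tau2 -addrA -mulrDl; congr (_ / _ + _ / _); ring.
have -> : tau1 kappa1 kappa2 0 + tau2 kappa1 kappa2 0 = f 0.
  exact: (congr1 (fun h : R -> R => h 0) fE).
rewrite fE; apply: cvgD; apply: cvgM.
- apply: cvgB; [exact: aff | apply: cvgM; [exact: aff | exact: cvg_id]].
- by apply: cvgV; [rewrite mulr0 addr0 subr_eq0 eq_sym | exact: aff].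
- exact: aff.
- by apply: cvgV; [rewrite mulr0 addr0 oner_eq0 | exact: aff].
Qed.

End Limits.

Theorem theorem2p3 (R : realType) :
  [/\ (forall (n m r : nat) (Omega : m.-tuple ('I_n * 'I_n))
         (X X0 : 'M[R]_n) (b eps0 kappa1 kappa2 : R),
         let p : R := m%:R / n%:R ^+ 2 in
         let POmega := sampling_op Omega in
         let PT := orth_proj (tangent_space r X) in
         \rank X = r ->
         \rank X0 = r ->
         1 < b ->
         0 < eps0 ->
         0 <= kappa1 ->
         0 <= kappa2 ->
         op_norm POmega <= 8 / 3 * b * ln n%:R ->
         op_norm (fun Z : 'M[R]_n => PT Z - p^-1 *: PT (POmega (PT Z))) <= eps0 ->
         frob_norm (X0 - X) / sigma_min X <=
           3 * Num.sqrt p * eps0 / (16 * b * ln n%:R * (1 + eps0)) ->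
         0 < (1 - 4 * eps0) - kappa1 * (1 + 4 * eps0) ->
         tau1 kappa1 kappa2 eps0 + tau2 kappa1 kappa2 eps0 < 1 ->
         nu_cg kappa1 kappa2 eps0 < 1 /\
         forall (Xs Ps : nat -> 'M[R]_n) (alpha beta : nat -> R),
           Xs 0%N = X0 ->
           restarted_rcg r Omega kappa1 kappa2 X Xs Ps alpha beta ->
           forall l : nat,
             frob_norm (Xs l - X) <=
               nu_cg kappa1 kappa2 eps0 ^+ l * frob_norm (X0 - X)),
      (forall eps0 : R, 0 < eps0 ->
         tau1 0 0 eps0 + tau2 0 0 eps0 < 1 <->
         18 * eps0 / (1 - 4 * eps0) < 1),
      (forall kappa1 kappa2 : R, 0 <= kappa1 -> 0 <= kappa2 -> kappa1 != 1 ->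
         tau1 kappa1 kappa2 e + tau2 kappa1 kappa2 e @[e --> (0 : R)^'] -->
           3 * kappa1 * kappa2),
      (forall kappa1 kappa2 : R, 0 <= kappa1 -> 0 <= kappa2 ->
         kappa1 * kappa2 < 1 / 3 ->
         \forall e \near (0 : R)^'+,
           tau1 kappa1 kappa2 e + tau2 kappa1 kappa2 e < 1) &
      (forall eps0 : R, 0 < eps0 -> eps0 <= 1 / 100 ->
         tau1 (1 / 10) 1 eps0 + tau2 (1 / 10) 1 eps0 < 1)].
Proof.
split.
- move=> n m r Omega X X0 b e k1 k2 p POmega PT Xr X0r b1 e0 k10 k20 hOm hrip hnear D0 tau.
  have [nu1 nu0 _ _] := nu_cg_facts e0 k10 k20 D0 tau.
  split=> // Xs Ps alpha beta Xs0 rcg.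
  (* For rank zero all iterates vanish; this case is separate because [sigma_min X] is then the
     infimum of an empty set. *)
  have [r0|r0] := posnP r.
    move=> l.
    have z (Y : 'M[R]_n) : (\rank Y <= r)%N -> Y = 0.
      by rewrite r0 leqn0 mxrank_eq0 => /eqP.
    have -> : Xs l = 0.
      case: l => [|l]; first by rewrite Xs0 (z X0) ?X0r.
      by apply: z; have [_ _ _ /hard_threshold_rank] := rcg l.
    rewrite (z X0) ?X0r // (z X) ?Xr // subrr.
    have fn0 : frob_norm (0 : 'M[R]_n) = 0 := mxnrm0 R n n.
    by rewrite fn0 mulr0.
  have [U [s [V [redX sig0 sigle]]]] := sigma_min_reduced_svd Xr r0.
  have [[UU VV _ _ XE] _] := redX.
  have n0 : (0 < n)%N by rewrite (leq_trans r0) // -Xr rank_leq_row.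
  have PTE Z : PT Z = tproj U V Z := orth_proj_tangentE Z redX.
  have projQ := tproj_orthogonal_projector UU VV.
  have [Qlin _ Qid] := projQ; have [_ _ _ _ QZ] := linear_op_facts Qlin.
  have OZ a Z : POmega (a *: Z) = a *: POmega Z.
    by have [_ _ _ _ h] := linear_op_facts (@sampling_linear R n m Omega); exact: h.
  have ripX Z : mxnrm (tproj U V Z - p^-1 *: tproj U V (POmega (tproj U V Z))) <= e * mxnrm Z.
    pose A (Z : 'M[R]_n) := PT Z - p^-1 *: PT (POmega (PT Z)).
    have AZ a W : A (a *: W) = a *: A W.
      by rewrite /A !PTE QZ OZ QZ [RHS]scalerBr !scalerA (mulrC a).
    have Abnd W : mxnrm (A W) <= (1 + `|p^-1| * m%:R) * mxnrm W.
      rewrite /A !PTE; apply: le_trans (mxnrmB _ _) _.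
      rewrite mulrDl mul1r lerD ?projector_contract // mxnrmZ -mulrA ler_wpM2l //.
      apply: le_trans (projector_contract _ projQ) _.
      apply: le_trans (sampling_norm_le _ _) _.
      by rewrite ler_wpM2l // projector_contract.
    have := mxnrm_le_op_norm AZ Abnd Z; rewrite /A !PTE => h; apply: le_trans h _.
    by rewrite ler_wpM2r ?mxnrm_ge0.
  have e4 : 0 < 1 - 4 * e.
    have h : 0 <= k1 * (1 + 4 * e) by rewrite mulr_ge0 //; lra.
    lra.
  (* With no samples [p^-1] is 0 by convention, so the isometry hypothesis would bound the identity
     on the tangent space by [e < 1]; the nonzero tangent vector [X] refutes it. *)
  have m0 : (0 < m)%N.
    rewrite lt0n; apply/negP => /eqP mz.
    have := ripX X; rewrite /p mz mul0r invr0 scale0r subr0.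
    have -> : tproj U V X = X.
      by rewrite /tproj {2}XE !mulmxA compl_projU // !mul0mx subr0.
    have Xp : 0 < mxnrm X.
      by rewrite mxnrm_gt0 -mxrank_eq0 Xr -lt0n.
    by rewrite ler_pMl //; lra.
  have p0 : 0 < p by rewrite divr_gt0 ?exprn_gt0 // ltr0n.
  pose L := 8 / 3 * b * ln (n%:R : R).
  have L1 : 1 <= L by exact: le_trans (@op_norm_sampling_ge1 R n m Omega m0) hOm.
  have pL : p <= L by exact: le_trans (@op_norm_sampling_ge_density R n m Omega n0) hOm.
  have OmB A : mxip (POmega A) (POmega A) <= L * mxip A (POmega A).
    apply: le_trans (sampling_bound _ _) _.
    by rewrite ler_wpM2r // sampling_nonneg.
  have near0 : 2 * (mxnrm (X0 - X) / sigma_min X) * (L * (1 + e)) <= Num.sqrt p * e.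
    have Le : 0 < L * (1 + e) by apply: mulr_gt0; lra.
    (* Hence [16 * b * ln n = 6 * L], which turns the factor [3 / 16] of the hypothesis into
       [1 / (2 L)]. *)
    have lnb : b * ln (n%:R : R) = 3 / 8 * L by rewrite /L; field.
    move: hnear; rewrite -[16 * b * _]mulrA lnb.
    have -> : 16 * (3 / 8 * L) * (1 + e) = 6 * (L * (1 + e)) by field.
    have Le6 : 0 < 6 * (L * (1 + e)) by apply: mulr_gt0.
    rewrite ler_pdivlMr // -[frob_norm _]/(mxnrm (X0 - X)); lra.
  exact: (rcg_error_bound r0 redX sig0 sigle OmB p0 L1 pL e0 k10 k20 D0 tau ripX near0 X0r Xs0 rcg).
- move=> e _; suff -> : tau1 0 0 e + tau2 0 0 e = 18 * e / (1 - 4 * e) by [].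
  rewrite /tau1 /tau2 !(mulr0, mul0r, addr0, subr0, add0r) //.
- move=> k1 k2 _ _ k1n; apply: cvg_within_filter; exact: cvg_tau_sum.
- move=> k1 k2 k10 k20 k12.
  (* At [k1 = 1] the first denominator is [- 8 * e], and cancelling [e] leaves [- 1 + 5 * e]: the
     limit differs from [3 * k1 * k2], but the sum still stays below 1. *)
  have [k11|k1n] := eqVneq k1 1.
    have k23 : k2 < 1 / 3 by move: k12; rewrite k11 mul1r.
    near=> e.
    have e0 : 0 < e by near: e; exact: nbhs_right_gt.
    have e1 : e < 1 / 100 by near: e; apply: nbhs_right_lt; lra.
    have d2 : 0 < 1 - 4 * e by lra.
    have -> : tau1 k1 k2 e + tau2 k1 k2 e = - 1 + 5 * e + 3 * (k2 * (1 + 4 * e)) / (1 - 4 * e).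
      rewrite k11 /tau1 /tau2; field; apply/andP; split; apply/eqP => h; lra.
    have h : 3 * (k2 * (1 + 4 * e)) / (1 - 4 * e) < 3 / 2.
      rewrite ltr_pdivrMr //; nra.
    lra.
  have : tau1 k1 k2 e + tau2 k1 k2 e @[e --> (0 : R)^'+] --> 3 * k1 * k2.
    by apply: cvg_within_filter; exact: cvg_tau_sum.
  move/cvgr_lt => h; apply: h; lra.
- move=> e e0 e1; rewrite /tau1 /tau2.
  have d1 : 0 < (1 - 4 * e) - 1 / 10 * (1 + 4 * e) by lra.
  have d2 : 0 < 1 - 4 * e by lra.
  (* The three quotients are bounded by 0.2, 0.15 and 0.3, in total 0.65. *)
  have h1 : (18 * e - 10 * (1 / 10) * e * (1 + 4 * e)) /
      ((1 - 4 * e) - 1 / 10 * (1 + 4 * e)) <= 2 / 10.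
    by rewrite ler_pdivrMr //; nra.
  have h2 : (4 * 1 * e + 1 / 10 * 1) / (1 - 4 * e) <= 15 / 100.
    by rewrite ler_pdivrMr //; lra.
  have h3 : (8 * 1 * e + 2 * (1 / 10) * 1) / (1 - 4 * e) <= 30 / 100.
    by rewrite ler_pdivrMr //; lra.
  lra.
Unshelve. all: by end_near.
Qed.
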